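(* For every closed convex lattice polygon $P\subseteq\mathbb{R}^2$ and every linear form $\ell:\mathbb{R}^2\to\mathbb{R}$, the weighted $h^*$-polynomial $h^*_{P,w}(t)$ of $P$ with respect to $w(x)=\ell^2(x)$ has only nonnegative coefficients.
   Context: For a $2$-dimensional lattice polygon $P$ and a homogeneous polynomial $w$ of degree $m$ on $\mathbb{R}^2$, $h^*_{P,w}(t)$ is the polynomial such that $\sum_{n\ge0}\big(\sum_{x\in nP\cap\mathbb{Z}^2}w(x)\big)t^n=h^*_{P,w}(t)/(1-t)^{m+3}$. The linear form $\ell$ need not be nonnegative on $P$. *)

(* Defs.v *)
From HB Require Import structures.
From mathcomp Require Import all_boot all_order all_algebra.
From mathcomp Require Import boolp classical_sets cardinality fsbigop reals.
From mathcomp Require Import convex.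
Set Implicit Arguments.
Unset Strict Implicit.
Unset Printing Implicit Defensive.

Import GRing.Theory.
Local Open Scope classical_set_scope.
Local Open Scope ring_scope.

Definition lattice_point (R : realType) (z : 'rV[int]_2) : 'rV[R]_2 :=
  map_mx intr z.

Definition convex_hull (R : realType) (A : set 'rV[R]_2) : set 'rV[R]_2 :=
  smallest (@convex_set R 'rV[R]_2) A.

(* The affine hull is the whole plane: P contains three affinely independent
   points. *)
Definition two_dimensional (R : realType) (P : set 'rV[R]_2) : Prop :=
  exists a b c : 'rV[R]_2,
    [/\ P a, P b, P c & row_free (col_mx (b - a) (c - a))].

Definition lattice_polygon (R : realType) (P : set 'rV[R]_2) : Prop :=
  two_dimensional P /\
  exists V : set 'rV[int]_2,
    finite_set V /\ P = convex_hull (@lattice_point R @` V).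

Definition dilate (R : realType) (n : nat) (P : set 'rV[R]_2) : set 'rV[R]_2 :=
  [set n%:R *: x | x in P].

(* The finitely supported sum ranges over a finite set when P is bounded. *)
Definition weighted_ehrhart (R : realType) (P : set 'rV[R]_2)
    (w : 'rV[R]_2 -> R) (n : nat) : R :=
  \sum_(z \in @lattice_point R @^-1` dilate n P) w (lattice_point R z).

(* The identity of formal power series
     \sum_n (weighted_ehrhart P w n) t^n = h(t) / (1 - t)^(m + 3),
   multiplied by (1 - t)^(m + 3) and read coefficientwise; m is the degree of
   the homogeneous weight w. *)
Definition is_weighted_hstar (R : realType) (P : set 'rV[R]_2) (m : nat)
    (w : 'rV[R]_2 -> R) (h : {poly R}) : Prop :=
  forall n : nat,
    \sum_(k < n.+1) ((1 - 'X) ^+ (m + 3) : {poly R})`_k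
                    * weighted_ehrhart P w (n - k) = h`_n.

Lemma is_weighted_hstar_unique (R : realType) (P : set 'rV[R]_2) (m : nat)
    (w : 'rV[R]_2 -> R) (h h' : {poly R}) :
  is_weighted_hstar P m w h -> is_weighted_hstar P m w h' -> h = h'.
Proof. by move=> hh hh'; apply/polyP => n; rewrite -hh -hh'. Qed.

(* Main.v *)
Require Import Defs.
From mathcomp Require Import all_boot all_order all_algebra.
From mathcomp Require Import classical_sets reals.
From mathcomp Require Import interval_inference unstable boolp cardinality fsbigop.
From mathcomp Require Import convex zify ring lra.
Set Implicit Arguments.
Unset Strict Implicit.
Unset Printing Implicit Defensive.

Import Order.TTheory GRing.Theory Num.Theory.
Local Open Scope classical_set_scope.
Local Open Scope ring_scope.

(** Let E(n) be the sum of l(x)^2 over the lattice points x of nP, and E'(n) the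
    same sum over the interior of nP.  Ehrhart reciprocity says that E(n) = e(n)
    and E'(n) = e(-n) for n >= 1, where e is a polynomial of degree at most 4
    with e(0) = 0; hence the coefficients of h* are
      h_1 = E(1),  h_2 = E(2) - 5 E(1),  h_3 = E'(2) - 5 E'(1),  h_4 = E'(1),
    and it remains to see that E(2) >= 5 E(1) and E'(2) >= 5 E'(1).

    Reciprocity is obtained for half-open lattice triangles by translating the
    lattice points of a fundamental parallelepiped, and is extended to polygons
    by cutting along chords between vertices.

    For the inequalities, let K be a bounded convex set.  Besides the doubles of
    the lattice points of K, the set 2K contains the sums v + w of any two of
    them.  If the lattice points s_1 < s_2 < ... of K are listed by increasing
    value a_i of l (ties broken lexicographically), then
      2 s_1 < s_1 + s_2 < 2 s_2 < s_2 + s_3 < ...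
    are distinct, and (a_i + a_(i+1))^2 >= a_i^2 + a_(i+1)^2 when the signs
    agree.  This proves the inequality unless exactly one point has its sign, in
    which case s_1 + s_3 is used as well; interiors with one or two lattice
    points are treated apart. *)

(** * Convex sets and barycentric coordinates *)

Section Convexity.
Variable R : realType.
Implicit Types (A B : set 'rV[R]_2) (x y p q r : 'rV[R]_2).

Lemma rV2P (T : Type) (x y : 'rV[T]_2) :
  x 0 0 = y 0 0 -> x 0 1 = y 0 1 -> x = y.
Proof.
move=> e0 e1; apply/matrixP => i j; rewrite ord1.
by case: j => -[|[|//]] hj; [move: e0|move: e1];
  congr (x _ _ = y _ _); apply/val_inj.
Qed.

Definition segment_closed A := forall x y (s : R),
  A x -> A y -> 0 <= s -> s <= 1 -> A (x + s *: (y - x)).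

Lemma convex_setP A : @convex_set R 'rV[R]_2 A <-> segment_closed A.
Proof.
split=> [cA x y s Ax Ay s0 s1|cA x y t].
  have /(_ y x (Itv01 s0 s1)) := cA; rewrite !inE => /(_ Ay Ax).
  suff -> : x + s *: (y - x) = conv (Itv01 s0 s1) (y : convex_lmodType 'rV[R]_2)
    (x : convex_lmodType 'rV[R]_2) by [].
  rewrite /conv /= /onem; apply: rV2P; rewrite !mxE /=; ring.
rewrite !inE => Ax Ay.
have t0 : 0 <= t%:num by [].
have t1 : t%:num <= 1 by [].
have := cA y x t%:num Ay Ax t0 t1.
set u := (X in A X -> _); set v := (X in _ -> A X).
suff -> : u = v by [].
rewrite /u /v /conv /= /onem; apply: rV2P; rewrite !mxE /=; ring.
Qed.

Lemma segment_closed_comb A x y (a b : R) : segment_closed A ->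
  A x -> A y -> 0 <= a -> 0 <= b -> a + b = 1 -> A (a *: x + b *: y).
Proof.
move=> cA Ax Ay a0 b0 ab.
have -> : a *: x + b *: y = x + b *: (y - x).
  by rewrite (_ : a = 1 - b); [apply: rV2P; rewrite !mxE; ring|lra].
by apply: cA => //; lra.
Qed.

Lemma segment_closed_comb3 A x y z (a b c : R) : segment_closed A ->
  A x -> A y -> A z -> 0 <= a -> 0 <= b -> 0 <= c -> a + b + c = 1 ->
  A (a *: x + b *: y + c *: z).
Proof.
move=> cA Ax Ay Az a0 b0 c0 abc.
have [ab0|ab0] := eqVneq (a + b) 0.
  have [-> -> ->] : [/\ a = 0, b = 0 & c = 1] by split; lra.
  by rewrite !scale0r !add0r scale1r.
have abge : 0 <= a + b by rewrite addr_ge0.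
have -> : a *: x + b *: y + c *: z =
    (a + b) *: ((a / (a + b)) *: x + (b / (a + b)) *: y) + c *: z.
  by apply: rV2P; rewrite !mxE; field.
apply: segment_closed_comb => //.
by apply: segment_closed_comb; rewrite ?divr_ge0 // -mulrDl divff.
Qed.

Lemma segment_closed_between A x y (u s : R) : segment_closed A ->
  A x -> A (x + s *: y) -> 0 <= u -> u <= s -> A (x + u *: y).
Proof.
move=> cA Ax Ay u0 us.
have [s0|s0] := eqVneq s 0.
  by rewrite (_ : u = 0) ?scale0r ?addr0 //; lra.
have sgt : 0 < s by rewrite lt_neqAle eq_sym s0 (le_trans u0).
have -> : x + u *: y = x + (u / s) *: (x + s *: y - x).
  by apply: rV2P; rewrite !mxE; field.
have sge : 0 <= s by exact: ltW.
by apply: cA; rewrite ?divr_ge0 // ler_pdivrMr // mul1r.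
Qed.

Lemma convex_hull_closed A : segment_closed (convex_hull A).
Proof.
move=> x y s hx hy s0 s1 B /= [cB AB].
by move/convex_setP : (cB); apply => //; [apply: hx|apply: hy].
Qed.

Lemma convex_hull_sub A B : segment_closed B -> A `<=` B -> convex_hull A `<=` B.
Proof. by move=> /convex_setP cB AB x; apply. Qed.

Lemma sub_convex_hull A : A `<=` convex_hull A.
Proof. exact: sub_gen_smallest. Qed.

Lemma convex_hull_mono A B : A `<=` B -> convex_hull A `<=` convex_hull B.
Proof.
move=> AB; apply: convex_hull_sub; first exact: convex_hull_closed.
exact: subset_trans AB (@sub_convex_hull B).
Qed.

(** The set is the union of the segments from [p] to points of [A]. A convex combination of two of
    its points gives [k1 - p] and [k2 - p] the weights [a] and [b] with [a + b <= 1], so it lies on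
    the segment from [p] to a weighted mean of [k1] and [k2]. *)
Lemma segment_closed_cone A p : segment_closed A ->
  segment_closed [set x | exists y s, [/\ A y, 0 <= s, s <= 1 &
                                         x = p + s *: (y - p)]].
Proof.
move=> cA _ _ t [k1 [s1 [Ak1 s10 s11 ->]]] [k2 [s2 [Ak2 s20 s21 ->]]] t0 t1.
have a0 : 0 <= (1 - t) * s1 by rewrite mulr_ge0 // subr_ge0.
have b0 : 0 <= t * s2 by rewrite mulr_ge0.
set a := (1 - t) * s1 in a0; set b := t * s2 in b0.
have ab1 : a + b <= 1 by rewrite /a /b; nra.
have [ab0|ab0] := eqVneq (a + b) 0.
  exists k1, 0; split => //.
  have [a00 b00] : a = 0 /\ b = 0 by split; lra.
  have -> : p + s1 *: (k1 - p) + t *: (p + s2 *: (k2 - p) - (p + s1 *: (k1 - p)))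
     = p + a *: (k1 - p) + b *: (k2 - p).
    by apply: rV2P; rewrite !mxE /a /b; ring.
  by rewrite a00 b00 !scale0r !addr0.
exists ((a / (a + b)) *: k1 + (b / (a + b)) *: k2), (a + b); split => //.
- have abge : 0 <= a + b by rewrite addr_ge0.
  by apply: segment_closed_comb; rewrite ?divr_ge0 // -mulrDl divff.
- exact: addr_ge0.
- move: ab0; rewrite /a /b => ab0.
  by apply: rV2P; rewrite !mxE; field.
Qed.

(** Each point of the hull other than [p] lies on a segment from [p] to a point of [K], at a
    positive parameter. If a segment between two such points met [p], a combination of [k1 - p] and
    [k2 - p] with nonnegative weights, not both zero, would vanish and put [p] in [K]. *)
Lemma extreme_convex_hull A p : ~ convex_hull (A `\ p) p ->
  segment_closed (convex_hull A `\ p).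
Proof.
set K := convex_hull (A `\ p) => nKp.
have cK : segment_closed K by exact: convex_hull_closed.
have hAc : convex_hull A `\ p `<=`
    [set x | exists y s, [/\ K y, 0 < s, s <= 1 & x = p + s *: (y - p)]].
  have hsub : convex_hull A `<=` p |` [set x | exists y s, [/\ K y, 0 <= s, s <= 1 &
                                         x = p + s *: (y - p)]].
    have [[k Kk]|K0] := pselect (exists k, K k).
      apply: (@subset_trans _ [set x | exists y s, [/\ K y, 0 <= s, s <= 1 &
                                         x = p + s *: (y - p)]]).
        apply: convex_hull_sub; first exact: segment_closed_cone.
        move=> x Ax; have [->|xp] := eqVneq x p.
          by exists k, 0; split => //; rewrite scale0r addr0.
        exists x, 1; split => //; last by rewrite scale1r addrC subrK.
        by apply: sub_convex_hull; split => //; apply/eqP.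
      by move=> x hx; right.
    apply: convex_hull_sub.
      move=> x y s [xp|[k [? [Kk]]]]; last by case: K0; exists k.
      move=> [yp|[k [? [Kk]]]]; last by case: K0; exists k.
      by move=> *; left; rewrite /= xp yp subrr scaler0 addr0.
    move=> x Ax; left; apply: contrapT => xp; case: K0; exists x.
    by apply: sub_convex_hull; split.
  move=> x [/hsub[xp /(_ xp)//|[k [s [Kk s0 s1 xE]]]]]; rewrite xE /= => xp.
  exists k, s; split => //; rewrite lt_neqAle s0 andbT eq_sym; apply/eqP => s00.
  by apply: xp; rewrite s00 scale0r addr0.
move=> x y t hx hy t0 t1; split.
  by apply: convex_hull_closed => //; [case: hx|case: hy].
move: (hAc _ hx) (hAc _ hy) => [k1 [s1 [Kk1 s10 s11 ->]]] [k2 [s2 [Kk2 s20 s21 ->]]].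
move=> /= e; apply: nKp.
set a := (1 - t) * s1; set b := t * s2.
have a0 : 0 <= a by rewrite mulr_ge0 ?subr_ge0 // ltW.
have b0 : 0 <= b by rewrite mulr_ge0 // ltW.
have ab0 : 0 < a + b.
  have [t00|tn0] := eqVneq t 0; first by rewrite /a /b t00; lra.
  have : 0 < t by rewrite lt_neqAle eq_sym tn0.
  by move=> tgt; rewrite /b in b0 *; rewrite ltr_wpDl // mulr_gt0.
suff -> : p = (a / (a + b)) *: k1 + (b / (a + b)) *: k2.
  have abge : 0 <= a + b by exact: ltW.
  by apply: segment_closed_comb; rewrite ?divr_ge0 // -mulrDl divff // gt_eqF.
have e2 : a *: (k1 - p) + b *: (k2 - p) = 0.
  have : p + s1 *: (k1 - p) + t *: (p + s2 *: (k2 - p) - (p + s1 *: (k1 - p))) - p = 0.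
    by rewrite e subrr.
  by move=> <-; apply: rV2P; rewrite !mxE /a /b; ring.
have -> : (a / (a + b)) *: k1 + (b / (a + b)) *: k2 =
    p + (a + b)^-1 *: (a *: (k1 - p) + b *: (k2 - p)).
  by apply: rV2P; rewrite !mxE; field; rewrite gt_eqF.
by rewrite e2 scaler0 addr0.
Qed.

Definition cross x y : R := x 0 0 * y 0 1 - x 0 1 * y 0 0.

(** Twice the signed area of the triangle. *)
Definition det3 p q r := cross p q + cross q r + cross r p.

(* The weight of [p] when the point [x / n] of the affine plane is written as a
   barycentric combination of [p], [q], [r], multiplied by [n]. *)
Definition bary p q r (n : R) x := (n * cross q r + cross x (q - r)) / det3 p q r.

Lemma det3_rot p q r : det3 q r p = det3 p q r.
Proof. by rewrite /det3; ring. Qed.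

Lemma det3_row p q r : det3 p q r = cross (q - p) (r - p).
Proof. by rewrite /det3 /cross !mxE; ring. Qed.

Section Triangle.
Variables p q r : 'rV[R]_2.
Hypothesis D0 : det3 p q r != 0.

Lemma bary_sum n x : bary p q r n x + bary q r p n x + bary r p q n x = n.
Proof.
rewrite /bary (det3_rot q r p) (det3_rot p q r) -!mulrDl.
apply: (mulIf D0); rewrite divfK //; rewrite /det3 /cross !mxE; ring.
Qed.

Lemma bary_vec n x :
  bary p q r n x *: p + bary q r p n x *: q + bary r p q n x *: r = x.
Proof.
apply: rV2P; rewrite !mxE /bary (det3_rot q r p) (det3_rot p q r);
apply: (mulIf D0); rewrite !mulrDl; rewrite -!mulrA ![_^-1 * (_ * _)]mulrCA;
 rewrite ![_^-1 * det3 _ _ _]mulVf // !mulr1; rewrite /det3 /cross !mxE; ring.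
Qed.

Lemma bary_comb a b c : bary p q r (a + b + c) (a *: p + b *: q + c *: r) = a.
Proof.
rewrite /bary; apply: (mulIf D0); rewrite divfK // /det3 /cross !mxE; ring.
Qed.

End Triangle.

(** [bary] is linear in the pair [(n, x)], a vector of the space that contains the plane at height
    1; directions have height 0. *)
Lemma baryD p q r m n x y : bary p q r (m + n) (x + y) = bary p q r m x + bary p q r n y.
Proof. by rewrite /bary -mulrDl; congr (_ / _); rewrite /cross !mxE; ring. Qed.

Lemma baryZ p q r n x s : bary p q r (s * n) (s *: x) = s * bary p q r n x.
Proof. by rewrite /bary mulrA; congr (_ / _); rewrite /cross !mxE; ring. Qed.

Lemma bary_affine p q r x u (s : R) :
  bary p q r 1 (x + s *: u) = bary p q r 1 x + s * bary p q r 0 u.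
Proof. by rewrite /bary mulrA -mulrDl; congr (_ / _); rewrite /cross !mxE; ring. Qed.

Lemma bary_sub p q r x y : bary p q r 0 (y - x) = bary p q r 1 y - bary p q r 1 x.
Proof. by rewrite /bary -mulrBl; congr (_ / _); rewrite /cross !mxE; ring. Qed.

End Convexity.

(** * Cutting a convex hull along a chord *)

Section Cutting.
Variable R : realType.
Implicit Types (A P : set 'rV[R]_2) (p q r x y u : 'rV[R]_2).

Definition pos_if (e : bool) (c : R) := if e then 0 < c else 0 <= c.

(** The i-th flag removes the edge opposite the i-th vertex. *)
Definition triangle p q r (e1 e2 e3 : bool) : set 'rV[R]_2 :=
  [set x | [/\ pos_if e1 (bary p q r 1 x), pos_if e2 (bary q r p 1 x)
             & pos_if e3 (bary r p q 1 x)]].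

(* The algebraic interior, which for a convex subset of the plane is the
   topological one. *)
Definition core A : set 'rV[R]_2 :=
  [set x | forall u, exists2 e : R, 0 < e & A (x + e *: u)].

Lemma core_sub A : core A `<=` A.
Proof. by move=> x /(_ 0)[e _]; rewrite scaler0 addr0. Qed.

(** The homothety with centre [y] and ratio [1 - s] carries the room around [x] to room around the
    new point. *)
Lemma core_mix A x y (s : R) : segment_closed A -> core A x -> A y ->
  0 <= s -> s < 1 -> core A (x + s *: (y - x)).
Proof.
move=> cA cx Ay s0 s1 u; have [e e0 Ae] := cx u.
exists ((1 - s) * e); first by rewrite mulr_gt0 // subr_gt0.
have := cA _ _ s Ae Ay s0 (ltW s1); congr (A _).
by apply: rV2P; rewrite !mxE; ring.
Qed.

Lemma core_closed A : segment_closed A -> segment_closed (core A).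
Proof.
move=> cA x y s cx cy s0 s1; have [->|sn1] := eqVneq s 1.
  by rewrite scale1r addrC subrK.
by apply: core_mix => //; [exact: core_sub|rewrite lt_neqAle sn1].
Qed.

Lemma bary_p p q r : det3 p q r != 0 -> bary p q r 1 p = 1.
Proof.
move=> D0; rewrite /bary; apply: (mulIf D0); rewrite divfK //.
by rewrite /det3 /cross !mxE; ring.
Qed.

Lemma bary_q p q r : bary p q r 1 q = 0.
Proof.
rewrite /bary (_ : _ + _ = 0) ?mul0r //.
by rewrite /cross !mxE; ring.
Qed.

Lemma bary_r p q r : bary p q r 1 r = 0.
Proof.
rewrite /bary (_ : _ + _ = 0) ?mul0r //.
by rewrite /cross !mxE; ring.
Qed.

Lemma bary0B p q r u v (t : R) :
  bary p q r 0 (u - t *: v) = bary p q r 0 u - t * bary p q r 0 v.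
Proof. by rewrite /bary mulrA -mulrBl; congr (_ / _); rewrite /cross !mxE; ring. Qed.

Lemma det3_rot_neq0 p q r : det3 p q r != 0 -> det3 q r p != 0.
Proof. by rewrite (det3_rot p q r). Qed.

Lemma small_pos (b c : R) : 0 < b ->
  exists2 e : R, 0 < e & forall s, 0 <= s -> s <= e -> 0 <= b + s * c.
Proof.
move=> b0; have c1 : 0 < 1 + `|c| by rewrite ltr_pwDl.
exists (b / (1 + `|c|)); first by rewrite divr_gt0.
move=> s s0; rewrite ler_pdivlMr // => sb.
have : - `|c| <= c by rewrite lerNl -normrN ler_norm.
by move=> hc; nra.
Qed.

Lemma pos_ifD (e : bool) (a b s t : R) : 0 <= s -> 0 <= t -> 0 < s + t ->
  pos_if e a -> pos_if e b -> pos_if e (s * a + t * b).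
Proof.
case: e => /= s0 t0 st a0 b0; last by rewrite addr_ge0 // mulr_ge0.
have [s00|sn] := eqVneq s 0.
  by rewrite s00 mul0r add0r mulr_gt0 //; lra.
by rewrite ltr_pwDl ?mulr_ge0 ?mulr_gt0 // ?ltW // lt_neqAle eq_sym sn.
Qed.

Lemma triangle_closed p q r e1 e2 e3 : segment_closed (triangle p q r e1 e2 e3).
Proof.
have aux e a b c x y s : 0 <= s -> s <= 1 -> pos_if e (bary a b c 1 x) ->
    pos_if e (bary a b c 1 y) -> pos_if e (bary a b c 1 (x + s *: (y - x))).
  move=> s0 s1 hx hy; rewrite bary_affine bary_sub.
  rewrite (_ : _ + _ = (1 - s) * bary a b c 1 x + s * bary a b c 1 y); last by ring.
  by apply: pos_ifD => //; [rewrite subr_ge0|rewrite subrK].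
by move=> x y s [x1 x2 x3] [y1 y2 y3] s0 s1; split; apply: aux.
Qed.

Lemma triangle_sub_convex A p q r : det3 p q r != 0 -> segment_closed A ->
  A p -> A q -> A r -> triangle p q r false false false `<=` A.
Proof.
move=> D0 cA Ap Aq Ar x [/= x1 x2 x3].
rewrite -(bary_vec D0 1 x); apply: segment_closed_comb3 => //.
exact: bary_sum.
Qed.

Lemma convex_hull_triangle A p q r : det3 p q r != 0 -> A p -> A q -> A r ->
  A `<=` triangle p q r false false false ->
  convex_hull A = triangle p q r false false false.
Proof.
move=> D0 Ap Aq Ar AT; apply/seteqP; split.
  by apply: convex_hull_sub => //; exact: triangle_closed.
apply: triangle_sub_convex => //; try exact: sub_convex_hull.
exact: convex_hull_closed.
Qed.

Lemma core_triangle p q r : det3 p q r != 0 ->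
  core (triangle p q r false false false) = triangle p q r true true true.
Proof.
move=> D0; have D1 := det3_rot_neq0 D0; have D2 := det3_rot_neq0 D1.
apply/seteqP; split => x.
  move=> cx; split => /=.
  - have [e e0 [/= + _ _]] := cx (q - p).
    by rewrite bary_affine bary_sub bary_p // bary_q; lra.
  - have [e e0 [/= _ + _]] := cx (r - q).
    by rewrite bary_affine bary_sub bary_p // bary_q; lra.
  - have [e e0 [/= _ _ +]] := cx (p - r).
    by rewrite bary_affine bary_sub bary_p // bary_q; lra.
move=> [/= x1 x2 x3] u.
have [e1 e10 h1] := small_pos (bary p q r 0 u) x1.
have [e2 e20 h2] := small_pos (bary q r p 0 u) x2.
have [e3 e30 h3] := small_pos (bary r p q 0 u) x3.
exists (Num.min e1 (Num.min e2 e3)); first by rewrite !lt_min e10 e20 e30.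
have e0 : 0 <= Num.min e1 (Num.min e2 e3) by rewrite !le_min !ltW.
split; rewrite /= bary_affine.
- by apply: h1; rewrite // ge_min lexx.
- by apply: h2; rewrite // !ge_min lexx orbT.
- by apply: h3; rewrite // !ge_min lexx !orbT.
Qed.

(** For [s < 0] the point [p] would lie strictly between [x] and [y], dividing the segment at
    [- s / (1 - s)]. *)
Lemma extreme_ray A p x y (s : R) : ~ convex_hull (A `\ p) p ->
  convex_hull A x -> convex_hull A y -> y != p -> x = p + s *: (y - p) -> 0 <= s.
Proof.
move=> np Px Py yp xE; rewrite leNgt; apply/negP => s0.
have cE := extreme_convex_hull np.
have xp : x != p.
  rewrite xE -subr_eq0 addrAC subrr add0r scaler_eq0 subr_eq0 (negbTE yp) orbF.
  by rewrite lt_eqF.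
have s1 : 0 < 1 - s by lra.
have := cE x y (- s / (1 - s)); case.
- by split => //; apply/eqP.
- by split => //; apply/eqP.
- by rewrite divr_ge0 ?ltW // oppr_gt0.
- by rewrite ler_pdivrMr //; lra.
move=> _; apply; rewrite /= xE; apply: rV2P; rewrite !mxE; field;
by rewrite gt_eqF.
Qed.

Section Cut.
Variables (A : set 'rV[R]_2) (p q r : 'rV[R]_2).
Hypotheses (D0 : det3 p q r != 0) (Ap : A p) (Aq : A q).
Hypotheses (np : ~ convex_hull (A `\ p) p) (nq : ~ convex_hull (A `\ q) q).

(** An affine form vanishing on the line through [p] and [q] and equal to 1 at [r]; its sign tells
    the two sides of the chord apart. *)
Let f := bary r p q 1.

Lemma chord_vec x : f x = 0 -> x = p + bary q r p 1 x *: (q - p).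
Proof.
move=> fx; have := bary_sum D0 1 x; have := bary_vec D0 1 x.
rewrite -/(f x) fx scale0r !addr0 => xE e; rewrite -{1}xE.
rewrite (_ : bary p q r 1 x = 1 - bary q r p 1 x); last lra.
by apply: rV2P; rewrite !mxE; ring.
Qed.

Lemma chord_neq : p != q.
Proof.
apply/eqP => pq; have := bary_p D0.
by rewrite {2}pq bary_q => /esym/eqP; rewrite oner_eq0.
Qed.

(** As [p] and [q] are extreme, the hull cannot prolong the chord beyond either end. *)
Lemma cut_chord x : convex_hull A x -> f x = 0 -> triangle p q r false false false x.
Proof.
move=> Px fx.
have hp := sub_convex_hull Ap; have hq := sub_convex_hull Aq.
have e := chord_vec fx; have sm := bary_sum D0 1 x.
split => /=; last by rewrite -/(f x) fx.
  apply: (extreme_ray nq Px hp chord_neq).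
  rewrite {1}e (_ : bary q r p 1 x = 1 - bary p q r 1 x).
    by apply: rV2P; rewrite !mxE; ring.
  by move: sm; rewrite -/(f x) fx; lra.
by apply: (extreme_ray np Px hq _ e); rewrite eq_sym chord_neq.
Qed.

Let C (sg : R) := convex_hull (A `&` [set x | 0 <= sg * f x]).

Let C_sub sg : C sg `<=` convex_hull A.
Proof. by apply: convex_hull_mono => x []. Qed.

Let faff sg x u s : sg * f (x + s *: u) = sg * f x + s * (sg * bary r p q 0 u).
Proof. by rewrite /f bary_affine; ring. Qed.

Let half_closed sg : segment_closed [set x | 0 <= sg * f x].
Proof.
move=> x y s /= hx hy s0 s1; rewrite faff bary_sub -/(f x) -/(f y).
have -> : sg * f x + s * (sg * (f y - f x)) = (1 - s) * (sg * f x) + s * (sg * f y).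
  by ring.
by rewrite addr_ge0 // mulr_ge0 // subr_ge0.
Qed.

Let C_ge0 sg x : C sg x -> 0 <= sg * f x.
Proof. by move: x; apply: convex_hull_sub; [exact: half_closed|move=> x []]. Qed.

Let C_chord sg x : convex_hull A x -> f x = 0 -> C sg x.
Proof.
move=> Px fx; have [/= x1 x2 x3] := cut_chord Px fx.
rewrite (chord_vec fx); apply: (@convex_hull_closed _ _ p q).
- by apply: sub_convex_hull; split => //=; rewrite /f bary_q mulr0.
- by apply: sub_convex_hull; split => //=; rewrite /f bary_r mulr0.
- by [].
- by have := bary_sum D0 1 x; rewrite -/(f x) fx; lra.
Qed.

(** The segment crosses the line at parameter [S], in a point of the chord and hence of [C sg]; up
    to [S] it stays in [C sg] by convexity. *)
Let C_mix sg x y s : sg != 0 -> C sg x -> C (- sg) y -> 0 <= s -> s <= 1 ->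
  0 <= sg * f (x + s *: (y - x)) -> C sg (x + s *: (y - x)).
Proof.
move=> sg0 Cx Cy s0 s1; have := C_ge0 Cx; have := C_ge0 Cy.
have Px := C_sub Cx; have Py := C_sub Cy.
rewrite mulNr oppr_ge0 => fy fx; rewrite faff bary_sub mulrBr => fw.
have [fy0|fyn0] := eqVneq (sg * f y) 0.
  apply: convex_hull_closed => //; apply: C_chord => //.
  by move/eqP : fy0; rewrite mulf_eq0 (negbTE sg0) => /eqP.
have fy1 : sg * f y < 0 by rewrite lt_neqAle fyn0.
have d0 : 0 < sg * f x - sg * f y by lra.
pose S := (sg * f x) / (sg * f x - sg * f y).
apply: (@segment_closed_between _ _ _ _ s S) => //.
- exact: convex_hull_closed.
- apply: C_chord.
    apply: convex_hull_closed => //; first by rewrite divr_ge0 // ltW.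
    by rewrite ler_pdivrMr //; lra.
  have : sg * f (x + S *: (y - x)) = 0.
    rewrite faff bary_sub mulrBr -/(f x) -/(f y) /S; field.
    by rewrite gt_eqF.
  by move/eqP; rewrite mulf_eq0 (negbTE sg0) => /eqP.
- by rewrite ler_pdivlMr //; move: fw; rewrite -/(f x) -/(f y); lra.
Qed.

(** No new vertex arises because the ends of the chord are generators. The union of the hulls on the
    two sides is convex and contains [A], hence the whole hull; a point of the opposite hull with
    [0 <= sg * f x] lies on the chord, which both hulls share. *)
Lemma cut_hull sg : sg != 0 ->
  convex_hull A `&` [set x | 0 <= sg * f x] =
  convex_hull (A `&` [set x | 0 <= sg * f x]).
Proof.
move=> sg0; have sgN : - sg != 0 by rewrite oppr_eq0.
apply/seteqP; split => x; last by move=> Cx; split; [exact: C_sub Cx|exact: C_ge0].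
move=> [Px /= fx].
have : (C sg `|` C (- sg)) x.
  move: x Px {fx}; apply: convex_hull_sub; last first.
    move=> x Ax; have [h|h] := leP 0 (sg * f x).
      by left; apply: sub_convex_hull.
    by right; apply: sub_convex_hull; split => //=; rewrite mulNr oppr_ge0 ltW.
  have mix x y s : C sg x -> C (- sg) y -> 0 <= s -> s <= 1 ->
      (C sg `|` C (- sg)) (x + s *: (y - x)).
    move=> Cx Cy s0 s1; have [h|h] := leP 0 (sg * f (x + s *: (y - x))).
      by left; apply: C_mix.
    right; have e : x + s *: (y - x) = y + (1 - s) *: (x - y).
      by apply: rV2P; rewrite !mxE; ring.
    rewrite e; apply: C_mix => //; rewrite ?opprK //; try lra.
    by rewrite -e mulNr oppr_ge0 ltW.
  move=> x y s [Cx|Cx] [Cy|Cy] s0 s1.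
  - by left; apply: convex_hull_closed.
  - exact: mix.
  - have -> : x + s *: (y - x) = y + (1 - s) *: (x - y).
      by apply: rV2P; rewrite !mxE; ring.
    by apply: mix => //; lra.
  - by right; apply: convex_hull_closed.
case=> // Cx; have := C_ge0 Cx; rewrite mulNr oppr_ge0 => fx'.
apply: C_chord => //; apply/eqP; have : sg * f x == 0 by rewrite eq_le fx fx'.
by rewrite mulf_eq0 (negbTE sg0).
Qed.

End Cut.

Lemma core_half P p q r (sg : R) : det3 p q r != 0 -> segment_closed P -> sg != 0 ->
  core (P `&` [set x | 0 <= sg * bary r p q 1 x]) =
  core P `&` [set x | 0 < sg * bary r p q 1 x].
Proof.
move=> D0 cP sg0; have D2 := det3_rot_neq0 (det3_rot_neq0 D0).
apply/seteqP; split => x.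
  move=> cx; split.
    by move=> u; have [e e0 [Pe _]] := cx u; exists e.
  have [e e0 [_ /=]] := cx (sg *: (p - r)).
  rewrite scalerA bary_affine bary_sub bary_p // bary_q sub0r.
  have : 0 < e * sg ^+ 2 by rewrite mulr_gt0 // exprn_even_gt0.
  by lra.
move=> [cx /= fx] u.
have [e e0 Pe] := cx u.
have [e' e'0 he'] := small_pos (sg * bary r p q 0 u) fx.
have e0m : 0 < Num.min e e' by rewrite lt_min e0.
exists (Num.min e e') => //; split.
  apply: (segment_closed_between cP (core_sub cx) Pe); first exact: ltW.
  by rewrite ge_min lexx.
rewrite /= bary_affine mulrDr [sg * (_ * _)]mulrCA; apply: he'; first exact: ltW.
by rewrite ge_min lexx orbT.
Qed.

(** The points [r] and [d] lie on opposite sides of the line, so an inner point of the chord has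
    room in [P] in every direction. Conversely, room along the chord keeps an interior point of [P]
    away from [p] and [q]. *)
Lemma core_chord P p q r d x : det3 p q r != 0 -> segment_closed P ->
  P p -> P q -> P r -> P d -> bary r p q 1 d < 0 ->
  (forall y, P y -> bary r p q 1 y = 0 -> triangle p q r false false false y) ->
  bary r p q 1 x = 0 ->
  core P x <-> triangle p q r true true false x.
Proof.
move=> D0 cP Pp Pq Pr Pd fd chord fx.
have D1 := det3_rot_neq0 D0; have D2 := det3_rot_neq0 D1.
split => [cx|[/= x1 x2 _]].
  split => /=; last by rewrite fx.
    have [e e0 Pe] := cx (q - p); have := chord _ Pe.
    rewrite bary_affine bary_sub bary_q bary_r subrr mulr0 addr0 => /(_ fx)[/= + _ _].
    by rewrite bary_affine bary_sub bary_p // bary_q; lra.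
  have [e e0 Pe] := cx (p - q); have := chord _ Pe.
  rewrite bary_affine bary_sub bary_q bary_r subrr mulr0 addr0 => /(_ fx)[/= _ + _].
  by rewrite bary_affine bary_sub bary_p // bary_r; lra.
move=> u.
(* [y] is taken on the side towards which [u] points, so that [u] is a multiple of [q - p] plus a
   nonnegative multiple of [y - p]. *)
have [y [Py fy0 t0]] : exists y, [/\ P y, bary r p q 1 y != 0 &
    0 <= bary r p q 0 u / bary r p q 1 y].
  have [h|h] := leP 0 (bary r p q 0 u).
    by exists r; rewrite bary_p // oner_eq0 divr1.
  exists d; rewrite lt_eqF //; split => //.
  by rewrite ltW // nmulr_rgt0 // invr_lt0.
set t := _ / _ in t0.
pose u' := u - t *: (y - p).
have fu' : bary r p q 0 u' = 0.
  by rewrite /u' bary0B bary_sub bary_q subr0 /t divfK // subrr.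
pose a := bary q r p 0 u'.
have uE : u' = a *: (q - p).
  have := bary_sum D0 0 u'; have := bary_vec D0 0 u'.
  rewrite fu' scale0r !addr0 => xE e; rewrite -{1}xE.
  rewrite -/a (_ : bary p q r 0 u' = - a); last by rewrite -/a in e; lra.
  by apply: rV2P; rewrite !mxE; ring.
have [e1 e10 h1] := small_pos a x2.
have [e2 e20 h2] := small_pos (- (a + t)) x1.
have e0 : 0 < Num.min e1 e2 by rewrite lt_min e10.
exists (Num.min e1 e2) => //; set e := Num.min e1 e2 in e0 *.
have := h1 e (ltW e0); rewrite ge_min lexx => /(_ isT) c1.
have := h2 e (ltW e0); rewrite ge_min lexx orbT => /(_ isT) c2.
have xs : bary p q r 1 x + bary q r p 1 x = 1.
  by have := bary_sum D0 1 x; rewrite fx addr0.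
have -> : x + e *: u = (bary p q r 1 x + e * - (a + t)) *: p +
     (bary q r p 1 x + e * a) *: q + (e * t) *: y.
  have -> : u = a *: (q - p) + t *: (y - p) by rewrite -uE /u' subrK.
  rewrite {1}(chord_vec D0 fx) (_ : bary p q r 1 x = 1 - bary q r p 1 x); last lra.
  by apply: rV2P; rewrite !mxE; ring.
by apply: segment_closed_comb3 => //; [rewrite mulr_ge0 // ltW|lra].
Qed.

End Cutting.

(** * Lattice points of half-open triangles *)

Section PowerSums.
Variable R : realType.
Implicit Types (a b c rho N : R).

(* The value, for a natural number [N], of the sum of
   [(rho + i a + j b + k c)^2] over [i + j + k = N]. *)
Definition simplex_sum a b c rho N : R :=
  (N + 1) * (N + 2) * (rho ^+ 2 / 2 +
    (rho * (a + b + c) / 3 +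
      (a ^+ 2 + b ^+ 2 + c ^+ 2 - (a * b + a * c + b * c)) / 12) * N +
    (a ^+ 2 + b ^+ 2 + c ^+ 2 + (a * b + a * c + b * c)) / 12 * N ^+ 2).

Lemma sum_segment b c rho M :
  \sum_(j <- iota 0 M) (rho + j%:R * b + (M.-1 - j)%:R * c) ^+ 2 =
  M%:R * (rho ^+ 2 + rho * (b + c) * (M%:R - 1)
    + (b ^+ 2 + c ^+ 2) * (M%:R - 1) * (2 * M%:R - 1) / 6
    + b * c * (M%:R - 1) * (M%:R - 2) / 3).
Proof.
elim: M rho => [|M IH] rho; first by rewrite big_nil mul0r.
rewrite /= big_cons subn0 (iotaDl 1 0 M) big_map.
under eq_bigr => j _.
  rewrite (_ : M - (1 + j) = M.-1 - j)%N; last by lia.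
  rewrite (_ : _ + _ = rho + b + j%:R * b + (M.-1 - j)%:R * c); last first.
    by rewrite natrD; ring.
  over.
by rewrite IH -[M.+1]addn1 natrD; field.
Qed.

(** Here [M] stands for [N + 1]. The layer [i = 0] is a [sum_segment]; the remaining layers form the
    same sum for [M - 1], with [rho + a] in place of [rho]. *)
Lemma sum_simplex a b c rho M :
  \sum_(i <- iota 0 M) \sum_(j <- iota 0 (M - i))
    (rho + i%:R * a + j%:R * b + (M.-1 - i - j)%:R * c) ^+ 2 =
  simplex_sum a b c rho (M%:R - 1).
Proof.
elim: M rho => [|M IH] rho.
  by rewrite big_nil /simplex_sum sub0r addNr !mul0r.
rewrite [iota 0 M.+1]/= big_cons (iotaDl 1 0 M) big_map.
under eq_bigr => i _.
  rewrite (_ : M.+1 - (1 + i) = M - i)%N; last by lia.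
  under eq_bigr => j _.
    rewrite (_ : M.+1.-1 - (1 + i) - j = M.-1 - i - j)%N; last by lia.
    rewrite (_ : _ + _ = rho + a + i%:R * a + j%:R * b + (M.-1 - i - j)%:R * c);
      last by rewrite natrD; ring.
    over.
  over.
rewrite IH subn0.
under eq_bigr => j _.
  rewrite subn0 mul0r addr0.
  over.
have := sum_segment b c rho M.+1; rewrite [M.+1.-1]/= => ->.
by rewrite /simplex_sum -[M.+1]addn1 natrD; field.
Qed.

Lemma simplex_sum_reciprocity a b c rho N :
  simplex_sum a b c rho (- 3 - N) = simplex_sum a b c (a + b + c - rho) N.
Proof. by rewrite /simplex_sum; field. Qed.

(** [F n = e(n)] and [G n = e(-n)] for the polynomial [e] with coefficients [c1], ..., [c4] and no
    constant term. The index 0 is left out because [esum] divides by [n]. *)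
Definition reciprocal (F G : nat -> R) := exists c1 c2 c3 c4 : R,
  forall n : nat, (0 < n)%N ->
    F n = c1 * n%:R + c2 * n%:R ^+ 2 + c3 * n%:R ^+ 3 + c4 * n%:R ^+ 4 /\
    G n = - c1 * n%:R + c2 * n%:R ^+ 2 - c3 * n%:R ^+ 3 + c4 * n%:R ^+ 4.

Lemma reciprocal_ext (F F' G G' : nat -> R) :
  (forall n, (0 < n)%N -> F n = F' n /\ G n = G' n) ->
  reciprocal F' G' -> reciprocal F G.
Proof.
move=> FG [c1 [c2 [c3 [c4 h]]]]; exists c1, c2, c3, c4 => n n0.
by have [-> ->] := FG _ n0; exact: h.
Qed.

Lemma reciprocalD (F F' G G' : nat -> R) : reciprocal F G -> reciprocal F' G' ->
  reciprocal (fun n => F n + F' n) (fun n => G n + G' n).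
Proof.
move=> [c1 [c2 [c3 [c4 h]]]] [d1 [d2 [d3 [d4 k]]]].
exists (c1 + d1), (c2 + d2), (c3 + d3), (c4 + d4) => n n0.
by have [-> ->] := h _ n0; have [-> ->] := k _ n0; split; ring.
Qed.

Lemma reciprocalN (F G : nat -> R) : reciprocal F G ->
  reciprocal (fun n => - F n) (fun n => - G n).
Proof.
move=> [c1 [c2 [c3 [c4 h]]]]; exists (- c1), (- c2), (- c3), (- c4) => n n0.
by have [-> ->] := h _ n0; split; ring.
Qed.

Lemma reciprocal_sum (I : eqType) (s : seq I) (F G : I -> nat -> R) :
  (forall i, i \in s -> reciprocal (F i) (G i)) ->
  reciprocal (fun n => \sum_(i <- s) F i n) (fun n => \sum_(i <- s) G i n).
Proof.
elim: s => [|i s IH] h.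
  by exists 0, 0, 0, 0 => n _; rewrite !big_nil; split; ring.
apply: (@reciprocal_ext _ (fun n => F i n + \sum_(j <- s) F j n) _
  (fun n => G i n + \sum_(j <- s) G j n)).
  by move=> n _; rewrite !big_cons.
apply: reciprocalD; first by apply: h; rewrite inE eqxx.
by apply: IH => j js; apply: h; rewrite inE js orbT.
Qed.

(* The conditions on [h] and [rho] make the polynomial vanish at [0]. *)
Lemma reciprocal_simplex a b c rho (h : nat) : (h <= 3)%N ->
  (h = 0%N -> rho = 0) -> (h = 3%N -> rho = a + b + c) ->
  reciprocal (fun n => simplex_sum a b c rho (n%:R - h%:R))
    (fun n => simplex_sum a b c (a + b + c - rho) (n%:R - (3 - h)%:R)).
Proof.
move=> h3 h0 hrho.
(* By reciprocity the second function is the first polynomial at [- n], since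
   [- 3 - (n - (3 - h)) = - n - h]. *)
apply: (@reciprocal_ext _ (fun n => simplex_sum a b c rho (n%:R - h%:R)) _
  (fun n => simplex_sum a b c rho (- n%:R - h%:R))).
  move=> n _; split => //; rewrite -simplex_sum_reciprocity natrB //.
  by congr simplex_sum; ring.
pose A := rho ^+ 2 / 2.
pose B := rho * (a + b + c) / 3 +
   (a ^+ 2 + b ^+ 2 + c ^+ 2 - (a * b + a * c + b * c)) / 12.
pose C := (a ^+ 2 + b ^+ 2 + c ^+ 2 + (a * b + a * c + b * c)) / 12.
have E N : simplex_sum a b c rho N = (N + 1) * (N + 2) * (A + B * N + C * N ^+ 2) by [].
(* The constant term is [(1 - h) (2 - h) (A - B h + C h^2)]: it vanishes for [h = 1] and [h = 2]
   through the first two factors, for [h = 0] because [A = 0], and for [h = 3] because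
   [A = 3 B - 9 C]. *)
case: h h0 h3 hrho => [|[|[|[|//]]]] h0 _ hrho.
- exists (2 * B), (3 * B + 2 * C), (B + 3 * C), C => n _.
  by rewrite !E (_ : A = 0); [split; ring|rewrite /A h0 // expr0n mul0r].
- exists (A - B + C), (A - C), (B - C), C => n _.
  by rewrite !E; split; ring.
- exists (- (A - 2 * B + 4 * C)), (A - 3 * B + 8 * C), (B - 5 * C), C => n _.
  by rewrite !E; split; ring.
- have e : A = 3 * B - 9 * C by rewrite /A /B /C hrho //; field.
  exists (2 * (B - 6 * C)), (- 3 * (B - 6 * C) + 2 * C), (B - 9 * C), C => n _.
  by rewrite !E e; split; ring.
Qed.

End PowerSums.

(** * Lattice points in dilates of a planar set *)

Section Lattice.
Variable R : realType.
Local Notation lat := (@lattice_point R).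
Implicit Types (A B : set 'rV[R]_2) (l : {scalar 'rV[R]_2}) (z v : 'rV[int]_2).

Lemma latD z z' : lat (z + z') = lat z + lat z'.
Proof. by rewrite /lattice_point map_mxD. Qed.

Lemma latB z z' : lat (z - z') = lat z - lat z'.
Proof. by rewrite /lattice_point map_mxB. Qed.

Lemma latM z k : lat (z *+ k) = k%:R *: lat z.
Proof.
by elim: k => [|k IH]; [rewrite mulr0n scale0r /lattice_point map_mx0|
  rewrite mulrSr latD IH -natr1 scalerDl scale1r].
Qed.

Lemma lat_inj : injective lat.
Proof.
move=> x y e; apply: rV2P; [move: e => /matrixP/(_ 0 0)|move: e => /matrixP/(_ 0 1)];
by rewrite !mxE => /intr_inj.
Qed.

Definition lset A (n : nat) : set 'rV[int]_2 := [set z | A (n%:R^-1 *: lat z)].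

Definition esum l A n : R := \sum_(z \in lset A n) l (lat z) ^+ 2.

Lemma esum_seq l A n s : uniq s -> (forall z, z \in s <-> lset A n z) ->
  esum l A n = \sum_(z <- s) l (lat z) ^+ 2.
Proof.
move=> us sA; rewrite /esum.
have -> : lset A n = [set` s] by apply/seteqP; split => z /sA.
by symmetry; apply: (fsbig_seq _ (fun z => l (lat z) ^+ 2) us).
Qed.

Lemma finite_lattice_ball (M : R) :
  finite_set [set z | `|lat z 0 0| <= M /\ `|lat z 0 1| <= M].
Proof.
have [K MK] : exists K : nat, M <= K%:R.
  exists (Num.bound `|M|); apply: le_trans (ler_norm _) _.
  exact/ltW/archi_boundP/normr_ge0.
pose zs := [seq Posz k - Posz K | k <- iota 0 (K + K).+1].
pose s := [seq (\row_(i < 2) if i == 0 then x else y) | x <- zs, y <- zs].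
have inzs (x : int) : `|x%:~R : R| <= M -> x \in zs.
  move=> /le_trans/(_ MK); rewrite -intr_norm -[K%:R]/(K%:~R : R) ler_int => xK.
  apply/mapP; exists (absz (x + K%:Z)); last by lia.
  by rewrite mem_iota; lia.
apply: (@sub_finite_set _ _ [set` s]); last by apply/finite_seqP; exists s.
move=> z /=; rewrite !mxE => -[z0 z1]; apply/allpairsP.
exists (z 0 0, z 0 1); rewrite !inzs //; split => //.
by apply: rV2P; rewrite !mxE.
Qed.

Definition bounded A := exists M : R, forall x, A x -> `|x 0 0| <= M /\ `|x 0 1| <= M.

Lemma finite_lset A n : (0 < n)%N -> bounded A -> finite_set (lset A n).
Proof.
move=> n0 [M AM].
apply: (@sub_finite_set _ _ [set z | `|lat z 0 0| <= n%:R * M /\ `|lat z 0 1| <= n%:R * M]);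
  last exact: finite_lattice_ball.
move=> z /AM; rewrite /= !mxE !normrM normfV normr_nat.
have nn : (0 : R) < n%:R by rewrite ltr0n.
by rewrite ![_^-1 * _]mulrC !ler_pdivrMr // ![M * _]mulrC.
Qed.

Lemma esumU l A B n : (0 < n)%N -> bounded A -> bounded B ->
  (forall x, A x -> B x -> False) -> esum l (A `|` B) n = esum l A n + esum l B n.
Proof.
move=> n0 bA bB AB; rewrite /esum -fsbigU0 //; try exact: finite_lset.
by move=> z [/AB h /h].
Qed.

Lemma bounded_triangle (p q r : 'rV[R]_2) e1 e2 e3 : det3 p q r != 0 ->
  bounded (triangle p q r e1 e2 e3).
Proof.
move=> D0.
have pos_ifW e (c : R) : pos_if e c -> 0 <= c by case: e => //= /ltW.
exists (`|p 0 0| + `|q 0 0| + `|r 0 0| + `|p 0 1| + `|q 0 1| + `|r 0 1|).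
move=> x [/pos_ifW h1 /pos_ifW h2 /pos_ifW h3]; have := bary_sum D0 1 x => sm.
rewrite -(bary_vec D0 1 x) !mxE.
have aux (a b c : R) : 0 <= a -> 0 <= b -> 0 <= c -> a + b + c = 1 ->
    forall s t u, `|a * s + b * t + c * u| <= `|s| + `|t| + `|u|.
  move=> a0 b0 c0 abc s t u.
  have n1 m w : 0 <= m -> m <= 1 -> `|m * w| <= `|w|.
    by move=> m0 m1; rewrite normrM ger0_norm // ler_piMl.
  apply: le_trans (ler_normD _ _) _; apply: lerD; last by apply: n1 => //; lra.
  by apply: le_trans (ler_normD _ _) _; apply: lerD; apply: n1 => //; lra.
split; apply: le_trans (aux _ _ _ h1 h2 h3 sm _ _ _) _.
  by have := normr_ge0 (p 0 1); have := normr_ge0 (q 0 1); have := normr_ge0 (r 0 1); lra.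
by have := normr_ge0 (p 0 0); have := normr_ge0 (q 0 0); have := normr_ge0 (r 0 0); lra.
Qed.

Lemma bary_scale (p q r x : 'rV[R]_2) (n : R) : n != 0 ->
  bary p q r 1 (n^-1 *: x) = n^-1 * bary p q r n x.
Proof. by move=> n0; rewrite -baryZ mulVf. Qed.

Lemma pos_if_scale e (a c : R) : 0 < a -> pos_if e (a * c) = pos_if e c.
Proof. by move=> a0; case: e => /=; rewrite ?pmulr_rgt0 // pmulr_rge0. Qed.

(** * Fundamental parallelepipeds of half-open triangles *)

Section HalfOpenTriangle.
Variables (l : {scalar 'rV[R]_2}) (v1 v2 v3 : 'rV[int]_2).
Local Notation p := (lat v1).
Local Notation q := (lat v2).
Local Notation r := (lat v3).
Hypothesis D0 : det3 p q r != 0.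
Let D1 : det3 q r p != 0 := det3_rot_neq0 D0.
Let D2 : det3 r p q != 0 := det3_rot_neq0 D1.

(** Half-open intervals of fractional parts, matched with [pos_if]: every [c] with [pos_if e c] is
    uniquely such a part plus a natural number. *)
Definition in_unit (e : bool) (c : R) := if e then 0 < c <= 1 else 0 <= c < 1.

Lemma in_unit_exists e c : pos_if e c -> exists k : nat, in_unit e (c - k%:R).
Proof.
move=> hc; pose Q (m : nat) := if e then c <= m%:R else c < m%:R.
have exQ : exists m, Q m.
  exists (Num.bound `|c|); have := archi_boundP (normr_ge0 c).
  by rewrite /Q; have := ler_norm c; case: ifP => _; lra.
case: (ex_minnP exQ) => -[|k] Qk kmin.
  by move: Qk hc; rewrite /Q /pos_if; case: ifP => _; lra.
exists k; have : ~~ Q k by apply/negP => /kmin; rewrite ltnn.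
by move: Qk; rewrite /Q /in_unit -addn1 natrD; case: ifP => _; lra.
Qed.

Lemma in_unit_uniq e c d (k k' : nat) : in_unit e c -> in_unit e d ->
  c + k%:R = d + k'%:R -> k = k'.
Proof.
move=> hc hd e1.
have : `|k%:Z - k'%:Z| < 1.
  rewrite -(ltr_int R) intr_norm rmorphB /= -!pmulrn.
  have -> : k%:R - k'%:R = d - c :> R by lra.
  by rewrite ltr_norml; move: hc hd; rewrite /in_unit; case: e => /andP[? ?] /andP[? ?];
    apply/andP; split; lra.
by lia.
Qed.

Lemma in_unit_half e c (k : nat) : in_unit e c -> pos_if e (c + k%:R).
Proof.
have := ler0n R k; rewrite /in_unit /pos_if; case: e => ? /andP[? ?]; lra.
Qed.

(** Reflection exchanges the two half-open intervals; this is why reciprocity complements the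
    flags. *)
Lemma in_unitN e c : in_unit e c = in_unit (~~ e) (1 - c).
Proof. by rewrite /in_unit; case: e => /=; apply/andP/andP => -[? ?]; split; lra. Qed.

(** The lattice points, paired with their heights, of the half-open fundamental parallelepiped
    spanned by the three vertices placed at height 1. *)
Definition box (e1 e2 e3 : bool) : set ('rV[int]_2 * nat) :=
  [set b | [/\ in_unit e1 (bary p q r b.2%:R (lat b.1)),
               in_unit e2 (bary q r p b.2%:R (lat b.1)) &
               in_unit e3 (bary r p q b.2%:R (lat b.1))]].

Lemma box_height e1 e2 e3 b : box e1 e2 e3 b -> (b.2 <= 3)%N.
Proof.
move=> [h1 h2 h3]; have := bary_sum D0 b.2%:R (lat b.1).
rewrite -(ler_nat R); move: h1 h2 h3.
by rewrite /in_unit; case: e1; case: e2; case: e3 => /andP[? ?] /andP[? ?] /andP[? ?]; lra.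
Qed.

(** Nonnegative weights with sum 0 all vanish. This and [box3] supply the conditions of
    [reciprocal_simplex]. *)
Lemma box0 e1 e2 e3 b : box e1 e2 e3 b -> b.2 = 0%N -> lat b.1 = 0.
Proof.
case: b => z h /= hb h0; move: hb; rewrite {h}h0 => -[/= h1 h2 h3].
have := bary_sum D0 0 (lat z); move: h1 h2 h3.
rewrite -[X in _ -> _ -> _ -> _ -> X = _](bary_vec D0 0 (lat z)) /in_unit.
case: e1; case: e2; case: e3 => /andP[? ?] /andP[? ?] /andP[? ?] sm; try by exfalso; lra.
rewrite (_ : bary p q r 0 _ = 0); last lra.
rewrite (_ : bary q r p 0 _ = 0); last lra.
rewrite (_ : bary r p q 0 _ = 0); last lra.
by rewrite !scale0r !addr0.
Qed.

Lemma box3 e1 e2 e3 b : box e1 e2 e3 b -> b.2 = 3%N -> lat b.1 = p + q + r.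
Proof.
case: b => z h /= hb h0; move: hb; rewrite {h}h0 => -[/= h1 h2 h3].
have := bary_sum D0 3 (lat z); move: h1 h2 h3.
rewrite -[X in _ -> _ -> _ -> _ -> X = _](bary_vec D0 3 (lat z)) /in_unit.
case: e1; case: e2; case: e3 => /andP[? ?] /andP[? ?] /andP[? ?] sm; try by exfalso; lra.
rewrite (_ : bary p q r 3 _ = 1); last lra.
rewrite (_ : bary q r p 3 _ = 1); last lra.
rewrite (_ : bary r p q 3 _ = 1); last lra.
by rewrite !scale1r.
Qed.

Lemma bary_shift m x (a b c : R) :
  [/\ bary p q r (m + (a + b + c)) (x + (a *: p + b *: q + c *: r)) = bary p q r m x + a,
      bary q r p (m + (a + b + c)) (x + (a *: p + b *: q + c *: r)) = bary q r p m x + b &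
      bary r p q (m + (a + b + c)) (x + (a *: p + b *: q + c *: r)) = bary r p q m x + c].
Proof.
split; rewrite baryD; congr (_ + _).
- exact: bary_comb.
- rewrite -addrA addrC -[X in bary q r p _ X]addrA [X in bary q r p _ X]addrC.
  exact: bary_comb.
- rewrite addrC addrA [X in bary r p q _ X]addrC [X in bary r p q _ X]addrA.
  exact: bary_comb.
Qed.

Lemma finite_box e1 e2 e3 : finite_set (box e1 e2 e3).
Proof.
have [M hM] := bounded_triangle false false false D0.
pose S := [set z | `|lat z 0 0| <= 3 * M /\ `|lat z 0 1| <= 3 * M].
apply: (@sub_finite_set _ _ (S `*` `I_4)).
  move=> b hb; split; last by rewrite /= ltnS; exact: box_height hb.
  have h3 := box_height hb.
  have [h0|h0] := posnP b.2.
    rewrite /S /= (box0 hb h0) !mxE normr0 mulr_ge0 //.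
    have [] := hM p; last by move=> /(le_trans (normr_ge0 _)).
    by split; rewrite /= ?bary_p ?bary_q ?bary_r.
  have hh : (0 : R) < b.2%:R by rewrite ltr0n.
  have := hM (b.2%:R^-1 *: lat b.1); case.
    case: hb => h1 h2 h4.
    have hl e c : in_unit e c -> 0 <= c by rewrite /in_unit; case: e => /andP[? ?]; lra.
    by split; rewrite /= bary_scale ?gt_eqF // mulr_ge0 ?invr_ge0 ?ler0n //;
      apply: hl; eassumption.
  have hz i : (b.2%:R^-1 *: lat b.1) 0 i = b.2%:R^-1 * lat b.1 0 i by rewrite mxE.
  rewrite !hz !normrM normfV normr_nat.
  rewrite ![_^-1 * _]mulrC !ler_pdivrMr // => k1 k2.
  have M0 : 0 <= M by move: (normr_ge0 (lat b.1 0 0)); nra.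
  have : b.2%:R <= (3 : R) by rewrite ler_nat.
  by move=> b3; split; nra.
by apply: finite_setX => //; exact: finite_lattice_ball.
Qed.


Lemma lset_triangle e1 e2 e3 n z : (0 < n)%N ->
  lset (triangle p q r e1 e2 e3) n z <->
  [/\ pos_if e1 (bary p q r n%:R (lat z)), pos_if e2 (bary q r p n%:R (lat z)) &
      pos_if e3 (bary r p q n%:R (lat z))].
Proof.
move=> n0; have nn : (0 : R) < n%:R by rewrite ltr0n.
rewrite /lset /triangle /= !bary_scale ?gt_eqF //.
have nV : (0 : R) < n%:R^-1 by rewrite invr_gt0.
by rewrite !(pos_if_scale _ _ nV).
Qed.

(** Each lattice point of the cone at height [n] is uniquely a box point [b] plus
    [i v1 + j v2 + k v3] with natural coefficients and [i + j + k = n - b.2], as one sees from the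
    integral and fractional parts of its weights. Each box point then contributes a
    [simplex_sum]. *)
Lemma esum_triangle e1 e2 e3 (B : seq ('rV[int]_2 * nat)) n : (0 < n)%N -> uniq B ->
  (forall b, b \in B <-> box e1 e2 e3 b) ->
  esum l (triangle p q r e1 e2 e3) n =
  \sum_(b <- B) simplex_sum (l p) (l q) (l r) (l (lat b.1)) (n%:R - b.2%:R).
Proof.
move=> n0 uB hB.
(* [T M] lists the pairs with [i + j < M]. For [M = n + 1 - b.2] they determine the third
   coefficient, and no subtraction truncates unless the list is empty. *)
pose T (M : nat) := [seq (i, j) | i <- iota 0 M, j <- iota 0 (M - i)].
have inT M ij : (ij \in T M) = (ij.1 + ij.2 < M)%N.
  apply/allpairsPdep/idP => [[i [j []]]|ijM].
    by rewrite !mem_iota !add0n /= => iM jM -> /=; lia.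
  case: ij ijM => i j /= ijM; exists i, j; rewrite !mem_iota !add0n !leq0n.
  by split => //; rewrite ?andTb; lia.
have height_inj (h h' i j : nat) : (i + j < n.+1 - h)%N -> (i + j < n.+1 - h')%N ->
    (n - h - i - j = n - h' - i - j)%N -> h = h' by lia.
have uT M : uniq (T M).
  apply: allpairs_uniq_dep; [exact: iota_uniq|by move=> *; exact: iota_uniq|].
  by move=> [i j] [i' j'] _ _ /= [-> ->].
pose g (b : 'rV[int]_2 * nat) (ij : nat * nat) : 'rV[int]_2 :=
  b.1 + v1 *+ ij.1 + v2 *+ ij.2 + v3 *+ (n - b.2 - ij.1 - ij.2).
have gE b ij : lat (g b ij) = lat b.1 +
    (ij.1%:R *: p + ij.2%:R *: q + (n - b.2 - ij.1 - ij.2)%:R *: r).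
  by rewrite /g !latD !latM !addrA.
have gcoord b ij : ij \in T (n.+1 - b.2)%N ->
  [/\ bary p q r n%:R (lat (g b ij)) = bary p q r b.2%:R (lat b.1) + ij.1%:R,
      bary q r p n%:R (lat (g b ij)) = bary q r p b.2%:R (lat b.1) + ij.2%:R &
      bary r p q n%:R (lat (g b ij)) =
        bary r p q b.2%:R (lat b.1) + (n - b.2 - ij.1 - ij.2)%:R].
  rewrite inT => hij; rewrite gE.
  have -> : n%:R = b.2%:R + (ij.1%:R + ij.2%:R + (n - b.2 - ij.1 - ij.2)%:R) :> R.
    by rewrite -!natrD; congr (_%:R); lia.
  exact: bary_shift.
pose s := [seq g b ij | b <- B, ij <- T (n.+1 - b.2)%N].
have us : uniq s.
  apply: allpairs_uniq_dep => // -[b ij] [b' ij'] /=.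
  move=> /allpairsPdep[b0 [ij0 [Bb Tij /= e]]] /allpairsPdep[b0' [ij0' [Bb' Tij' /= e']]].
  move: e e' => [<- <-] [<- <-] in Bb Tij Bb' Tij' *.
  move=> {b0 b0' ij0 ij0'} geq.
  have [c1 c2 c3] := gcoord _ _ Tij; have [c1' c2' c3'] := gcoord _ _ Tij'.
  rewrite geq in c1 c2 c3.
  have [u1 u2 u3] := (hB b).1 Bb; have [u1' u2' u3'] := (hB b').1 Bb'.
  have e1' := in_unit_uniq u1 u1' (etrans (esym c1) c1').
  have e2' := in_unit_uniq u2 u2' (etrans (esym c2) c2').
  have e3' := in_unit_uniq u3 u3' (etrans (esym c3) c3').
  move: geq Tij Tij'; rewrite !inT /g e3' e1' e2' => geq Tij Tij'.
  have eb : b = b'.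
    have e21 : b.2 = b'.2 by apply: height_inj Tij Tij' _; rewrite -{1}e1' -{1}e2' e3'.
    have e11 : b.1 = b'.1 by move: geq => /addIr/addIr/addIr.
    by move: e21 e11; case: (b) (b') => [? ?] [? ?] /= -> ->.
  by rewrite eb; congr existT; case: (ij) (ij') e1' e2' => [? ?] [? ?] /= -> ->.
have sP z : z \in s <-> lset (triangle p q r e1 e2 e3) n z.
  rewrite lset_triangle //; split.
    move=> /allpairsPdep[b [ij [Bb Tij ->]]].
    have [-> -> ->] := gcoord _ _ Tij; have [u1 u2 u3] := (hB b).1 Bb.
    by split; exact: in_unit_half.
  move=> [/in_unit_exists[k1 u1] /in_unit_exists[k2 u2] /in_unit_exists[k3 u3]].
  have kn : (k1 + k2 + k3 <= n)%N.
    rewrite -(ler_nat R) !natrD; have := bary_sum D0 n%:R (lat z).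
    move: u1 u2 u3; rewrite /in_unit.
    by case: (e1); case: (e2); case: (e3) => /andP[? ?] /andP[? ?] /andP[? ?]; lra.
  pose b : 'rV[int]_2 * nat := (z - v1 *+ k1 - v2 *+ k2 - v3 *+ k3, (n - (k1 + k2 + k3))%N).
  have Tk : (k1, k2) \in T (n.+1 - b.2)%N by rewrite inT /=; lia.
  have zE : z = g b (k1, k2).
    rewrite /g /= (_ : n - _ - k1 - k2 = k3)%N; last by lia.
    move: (v1 *+ k1) (v2 *+ k2) (v3 *+ k3) => a b' c.
    by apply: rV2P; rewrite !mxE; ring.
  apply/allpairsPdep; exists b, (k1, k2); split => //.
  apply/hB; have := gcoord _ _ Tk; rewrite -zE /= => -[c1 c2 c3].
  move: c3; rewrite (_ : n - _ - k1 - k2 = k3)%N; last by lia.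
  by move=> c3; split => /=; [move: u1; rewrite c1|move: u2; rewrite c2|move: u3; rewrite c3];
    rewrite addrK.
rewrite (esum_seq l us sP) big_allpairs_dep; apply: eq_big_seq => b /hB hb.
have h3 := box_height hb.
have -> : simplex_sum (l p) (l q) (l r) (l (lat b.1)) (n%:R - b.2%:R) =
    simplex_sum (l p) (l q) (l r) (l (lat b.1)) ((n.+1 - b.2)%:R - 1).
  have [bn|bn] := leqP b.2 n.+1.
    by rewrite natrB // -natr1; congr simplex_sum; ring.
  (* Truncation matters only here: the list of pairs is empty, and the polynomial vanishes at
     [N = -2]. *)
  have [-> ->] : n = 1%N /\ b.2 = 3%N.
    by move: (b.2) h3 bn => h h3 bn; clear -h3 bn n0; lia.
  by rewrite (_ : (2 - 3)%N = 0%N) // /simplex_sum; ring.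
rewrite -sum_simplex big_allpairs_dep; apply: eq_bigr => i _; apply: eq_bigr => j _.
rewrite gE !linearD !linearZ /= !addrA; congr ((_ + _ * _) ^+ 2); congr (_%:R).
by move: (b.2) => h; clear; lia.
Qed.

(** The map [op], sending [(z, h)] to [(v1 + v2 + v3 - z, 3 - h)], replaces every weight [c] by
    [1 - c] and so matches the boxes of complementary flags; [reciprocal_simplex] is then applied to
    each box point. *)
Lemma triangle_reciprocity e1 e2 e3 :
  reciprocal (esum l (triangle p q r e1 e2 e3))
             (esum l (triangle p q r (~~ e1) (~~ e2) (~~ e3))).
Proof.
have /finite_seqP[B0 B0E] := finite_box e1 e2 e3.
pose B := undup B0; have uB : uniq B := undup_uniq B0.
have hB b : b \in B <-> box e1 e2 e3 b by rewrite mem_undup B0E.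
pose op (b : 'rV[int]_2 * nat) := (v1 + v2 + v3 - b.1, (3 - b.2)%N).
have opK b : (b.2 <= 3)%N -> op (op b) = b.
  by case: b => z h /= h3; rewrite /op /= subKr subKn.
have op_box e1' e2' e3' b : box e1' e2' e3' b -> box (~~ e1') (~~ e2') (~~ e3') (op b).
  move=> hb; have h3 := box_height hb; case: hb => u1 u2 u3.
  have sh : [/\ bary p q r 3 (p + q + r) = 1, bary q r p 3 (p + q + r) = 1 &
                bary r p q 3 (p + q + r) = 1].
    have := bary_shift 0 0 1 1 1; rewrite add0r !scale1r add0r.
    have z0 a b' c : bary a b' c 0 (0 : 'rV[R]_2) = 0.
      by have := baryZ a b' c 0 0 0; rewrite !mul0r scale0r.
    by rewrite !z0 !add0r (_ : 1 + 1 + 1 = 3) //; ring.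
  have opE a b' c : bary a b' c (op b).2%:R (lat (op b).1) =
      bary a b' c 3 (p + q + r) - bary a b' c b.2%:R (lat b.1).
    rewrite /op /= latB !latD natrB //.
    by apply/eqP; rewrite eq_sym subr_eq -baryD !subrK.
  by case: sh => s1 s2 s3; split; rewrite /= opE ?s1 ?s2 ?s3 -in_unitN.
have uB' : uniq (map op B).
  rewrite map_inj_in_uniq // => b b' /hB hb /hB hb' e.
  by rewrite -(opK b (box_height hb)) -(opK b' (box_height hb')) e.
have hB' b : b \in map op B <-> box (~~ e1) (~~ e2) (~~ e3) b.
  split=> [/mapP[b' /hB hb' ->]|hb]; first exact: op_box.
  rewrite -(opK b (box_height hb)); apply: map_f; apply/hB.
  by have := op_box _ _ _ _ hb; rewrite !negbK.
apply: (@reciprocal_ext _ _ (fun n => \sum_(b <- B)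
    simplex_sum (l p) (l q) (l r) (l (lat b.1)) (n%:R - b.2%:R)) _ (fun n => \sum_(b <- B)
    simplex_sum (l p) (l q) (l r) (l p + l q + l r - l (lat b.1)) (n%:R - (3 - b.2)%:R))).
  move=> n n0; split; first exact: esum_triangle.
  rewrite (esum_triangle n0 uB' hB') big_map; apply: eq_bigr => b _ /=.
  by rewrite latB !latD linearB !linearD.
apply: reciprocal_sum => b /hB hb; apply: reciprocal_simplex.
- exact: box_height hb.
- by move=> h0; rewrite (box0 hb h0) linear0.
- by move=> h0; rewrite (box3 hb h0) !linearD.
Qed.

End HalfOpenTriangle.
End Lattice.

(** * Reciprocity for lattice polygons *)

Section Polygon.
Variable R : realType.
Local Notation lat := (@lattice_point R).
Implicit Types (A B : set 'rV[R]_2) (l : {scalar 'rV[R]_2}) (z v : 'rV[int]_2).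

Lemma det3_affine (a b x y : 'rV[R]_2) (s : R) :
  det3 a b (x + s *: (y - x)) = (1 - s) * det3 a b x + s * det3 a b y.
Proof. by rewrite /det3 /cross !mxE; ring. Qed.

(** [det3] is affine in each argument, so its vanishing passes from the generators to the hull one
    argument at a time, with a rotation in between. *)
Lemma det3_hull A : (forall a b c, A a -> A b -> A c -> det3 a b c = 0) ->
  forall x y z : 'rV[R]_2, convex_hull A x -> convex_hull A y -> convex_hull A z ->
  det3 x y z = 0.
Proof.
move=> hA.
have step a b : (forall c, A c -> det3 a b c = 0) ->
    forall c, convex_hull A c -> det3 a b c = 0.
  move=> hab; apply: (@convex_hull_sub _ _ [set c | det3 a b c = 0]) => //.
  by move=> x y s /= hx hy _ _; rewrite det3_affine hx hy !mulr0 addr0.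
move=> x y z hx hy hz; rewrite -(det3_rot x y z); apply: (step _ _ _ _ hx) => a Aa.
rewrite -(det3_rot y z a); apply: (step _ _ _ _ hy) => b Ab.
by rewrite -(det3_rot z a b); apply: (step _ _ _ _ hz) => c Ac; apply: hA.
Qed.

Lemma bounded_sub A B : A `<=` B -> bounded B -> bounded A.
Proof. by move=> AB [M hM]; exists M => x /AB /hM. Qed.

Definition lattice_hull (V : seq 'rV[int]_2) := convex_hull (lat @` [set` V]).

Lemma bounded_lattice_hull V : bounded (lattice_hull V).
Proof.
exists (\sum_(v <- V) (`|lat v 0 0| + `|lat v 0 1|)).
apply: convex_hull_sub.
  move=> x y s [x0 x1] [y0 y1] s0 s1; rewrite !mxE.
  have aux (M a b : R) : `|a| <= M -> `|b| <= M -> `|a + s * (b - a)| <= M.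
    by rewrite !ler_norml => /andP[? ?] /andP[? ?]; apply/andP; split; nra.
  by split; apply: aux.
move=> _ [v /= vV <-]; rewrite (big_rem v vV) /=.
have := normr_ge0 (lat v 0 0); have := normr_ge0 (lat v 0 1).
have : 0 <= \sum_(y <- rem v V) (`|lat y 0 0| + `|lat y 0 1|).
  by apply: sumr_ge0 => i _; rewrite addr_ge0.
by move=> ? ? ?; split; lra.
Qed.

Lemma size_filter_lt (T : eqType) (a : pred T) (s : seq T) x :
  x \in s -> ~~ a x -> (size (filter a s) < size s)%N.
Proof.
move=> xs ax; rewrite size_filter -(count_predC a s) -{1}[count a s]addn0.
by rewrite ltn_add2l -has_count; apply/hasP; exists x.
Qed.

Lemma image_filter (a : pred 'rV[int]_2) (Q : set 'rV[R]_2) V :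
  (forall v, v \in V -> a v <-> Q (lat v)) ->
  (lat @` [set` V]) `&` Q = lat @` [set` filter a V].
Proof.
move=> aQ; apply/seteqP; split.
  by move=> _ [[v /= vV <-] /(aQ _ vV) av]; exists v => //=; rewrite mem_filter av.
move=> x [v /= + <-]; rewrite mem_filter => /andP[av vV].
by split; [exists v|apply/aQ].
Qed.

Lemma bary_det3 (p q r x : 'rV[R]_2) : bary p q r 1 x = det3 x q r / det3 p q r.
Proof. by rewrite /bary; congr (_ / _); rewrite /det3 /cross !mxE; ring. Qed.

(** The segment from [p] to [q], without its ends when [e] holds. *)
Definition chord (p q r : 'rV[R]_2) (e : bool) :=
  triangle p q r e e false `&` [set x | bary r p q 1 x = 0].

Lemma esum_chord l v1 v2 v3 e n : det3 (lat v1) (lat v2) (lat v3) != 0 -> (0 < n)%N ->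
  esum l (chord (lat v1) (lat v2) (lat v3) e) n =
  esum l (triangle (lat v1) (lat v2) (lat v3) e e false) n -
  esum l (triangle (lat v1) (lat v2) (lat v3) e e true) n.
Proof.
move=> D0 n0; set p := lat v1; set q := lat v2; set r := lat v3.
have -> : triangle p q r e e false = triangle p q r e e true `|` chord p q r e.
  apply/seteqP; split => x.
    move=> hx; case: (hx) => h1 h2 /=.
    rewrite le_eqVlt => /orP[/eqP h3|h3]; last by left.
    by right; split.
  by move=> [[h1 h2 /= /ltW h3]|[]].
rewrite esumU //; first by rewrite addrAC subrr add0r.
- exact: bounded_triangle.
- by apply: bounded_sub (bounded_triangle e e false D0) => x [].
- by move=> x [_ _ /= +] [_ /= e0]; rewrite e0 ltxx.
Qed.

Lemma esum_split l A (f : 'rV[R]_2 -> R) n : bounded A -> (0 < n)%N ->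
  esum l A n = esum l (A `&` [set x | 0 < f x]) n + esum l (A `&` [set x | f x < 0]) n
     + esum l (A `&` [set x | f x = 0]) n.
Proof.
move=> bA n0.
have sb Q : bounded (A `&` Q) by apply: bounded_sub bA => x [].
rewrite -!esumU //.
- congr (esum l _ n); apply/seteqP; split => x; last by move=> [[[]|[]]|[]].
  by move=> Ax; have [h|h|h] := ltgtP 0 (f x); [left; left|left; right|right].
- by apply: bounded_sub bA => x [[]|[]].
- by move=> x [[_ /= h]|[_ /= h]] [_ /= h']; rewrite h' ltxx in h.
- by move=> x [_ /= h] [_ /= h']; move: (lt_trans h h'); rewrite ltxx.
Qed.

(** The closed pieces count the chord twice, and the open pieces miss its inner points: the closed
    chord is subtracted, the open one added. Written as differences of half-open triangles, the
    closed chord is reciprocal to minus the open one, so the signs agree. *)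
Lemma cut_reciprocity l (P : set 'rV[R]_2) v1 v2 v3 (d : 'rV[R]_2)
  (p := lat v1) (q := lat v2) (r := lat v3) (f := bary r p q 1) :
  det3 p q r != 0 -> bounded P -> segment_closed P ->
  P p -> P q -> P r -> P d -> f d < 0 ->
  (forall y, P y -> f y = 0 -> triangle p q r false false false y) ->
  reciprocal (esum l (P `&` [set x | 0 <= 1 * f x]))
             (esum l (core (P `&` [set x | 0 <= 1 * f x]))) ->
  reciprocal (esum l (P `&` [set x | 0 <= -1 * f x]))
             (esum l (core (P `&` [set x | 0 <= -1 * f x]))) ->
  reciprocal (esum l P) (esum l (core P)).
Proof.
move=> D0 bP cP Pp Pq Pr Pd fd hch r1 r2.
have r3 := triangle_reciprocity l D0 false false false.
have r4 := triangle_reciprocity l D0 false false true.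
have := reciprocalD (reciprocalD r1 r2) (reciprocalD (reciprocalN r3) r4).
have PT : triangle p q r false false false `<=` P by exact: triangle_sub_convex.
have sb Q : bounded (P `&` Q) by apply: bounded_sub bP => x [].
apply: reciprocal_ext => n n0.
have chP : P `&` [set x | f x = 0] = chord p q r false.
  apply/seteqP; split => x [h1 /= h2]; split => //; [exact: hch|exact: PT].
have chc : core P `&` [set x | f x = 0] = chord p q r true.
  by apply/seteqP; split => x [h1 /= h2]; split => //;
     apply/(core_chord D0 cP Pp Pq Pr Pd fd hch).
split.
  rewrite (esum_split l f bP n0) chP.
  rewrite (_ : P `&` [set x | 0 <= 1 * f x] = (P `&` [set x | 0 < f x]) `|` chord p q r false).
  rewrite (_ : P `&` [set x | 0 <= -1 * f x] = (P `&` [set x | f x < 0]) `|` chord p q r false).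
  rewrite !esumU //; first by rewrite (esum_chord l false D0 n0); ring.
  - by rewrite -chP.
  - by move=> x [_ /= h] [_ /= h']; move: h; rewrite /f h' ltxx.
  - by rewrite -chP.
  - by move=> x [_ /= h] [_ /= h']; move: h; rewrite /f h' ltxx.
  - rewrite -chP -setIUr; congr (_ `&` _); apply/seteqP; split => x /=; rewrite mulN1r oppr_ge0.
      by rewrite le_eqVlt => /orP[/eqP ?|?]; [right|left].
    by move=> [/ltW//|->].
  - rewrite -chP -setIUr; congr (_ `&` _); apply/seteqP; split => x /=; rewrite mul1r.
      by rewrite le_eqVlt => /orP[/eqP ?|?]; [right|left].
    by move=> [/ltW//|->].
have bc : bounded (core P) by apply: bounded_sub bP; exact: core_sub.
rewrite (esum_split l f bc n0) chc (esum_chord l true D0 n0).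
rewrite !core_half ?oppr_eq0 ?oner_eq0 //.
rewrite (_ : [set x | 0 < 1 * f x] = [set x | 0 < f x]); last first.
  by apply/seteqP; split => x /=; rewrite mul1r.
rewrite (_ : [set x | 0 < -1 * f x] = [set x | f x < 0]); last first.
  by apply/seteqP; split => x /=; rewrite mulN1r oppr_gt0.
by rewrite /=; ring.
Qed.

(** Induction on the number of generators. A redundant generator is dropped; if a triangle of
    generators contains all the others, it is the polygon; otherwise a side of it separates some
    generator [d] from the third vertex [r], and the polygon is cut along that side. *)
Lemma polygon_reciprocity l V :
  (exists x y z : 'rV[R]_2, [/\ lattice_hull V x, lattice_hull V y, lattice_hull V z &
                     det3 x y z != 0]) ->
  reciprocal (esum l (lattice_hull V)) (esum l (core (lattice_hull V))).
Proof.
have [m mV] := ubnP (size V); elim: m V mV => // m IH V; rewrite ltnS => mV hdim.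
have [a [b [c [Va Vb Vc D0]]]] : exists a b c,
    [/\ a \in V, b \in V, c \in V & det3 (lat a) (lat b) (lat c) != 0].
  apply: contrapT => hn; case: hdim => x [y [z [hx hy hz /eqP]]]; apply.
  apply: (det3_hull _ hx hy hz) => _ _ _ [a /= Va <-] [b /= Vb <-] [c /= Vc <-].
  by apply/eqP; apply/negPn/negP => D0; apply: hn; exists a, b, c.
have [[v [vV hv]]|hext] := pselect (exists v, v \in V /\
    convex_hull ((lat @` [set` V]) `\ lat v) (lat v)).
  have e : lattice_hull V = lattice_hull [seq u <- V | u != v].
    rewrite /lattice_hull -(@image_filter _ [set x | x <> lat v]); last first.
      by move=> u _; split => [/eqP h /lat_inj //|h]; apply/eqP => uv; rewrite uv in h.
    apply/seteqP; split; last by apply: convex_hull_mono => x [].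
    apply: convex_hull_sub; first exact: convex_hull_closed.
    move=> x Vx; have [->//|xv] := eqVneq x (lat v).
    by apply: sub_convex_hull; split => //; apply/eqP.
  rewrite e; apply: IH; last by rewrite -e.
  by apply: leq_trans mV; apply: (size_filter_lt vV); rewrite eqxx.
have ext v : v \in V -> ~ convex_hull ((lat @` [set` V]) `\ lat v) (lat v).
  by move=> vV hv; apply: hext; exists v.
have [sub|nsub] := pselect (lat @` [set` V] `<=`
    triangle (lat a) (lat b) (lat c) false false false).
  rewrite /lattice_hull (convex_hull_triangle D0 _ _ _ sub).
  - by rewrite core_triangle //; exact: triangle_reciprocity.
  - by exists a.
  - by exists b.
  - by exists c.
have [v1 [v2 [v3 [d [V1 V2 V3 Vd [{}D0 fd]]]]]] : exists v1 v2 v3 d,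
    [/\ v1 \in V, v2 \in V, v3 \in V, d \in V &
        det3 (lat v1) (lat v2) (lat v3) != 0 /\
        bary (lat v3) (lat v1) (lat v2) 1 (lat d) < 0].
  apply: contrapT => hn; apply: nsub => _ [d /= Vd <-]; split => /=; rewrite leNgt.
  - apply/negP => h; apply: hn; exists b, c, a, d; split => //; split => //.
    exact: det3_rot_neq0.
  - apply/negP => h; apply: hn; exists c, a, b, d; split => //; split => //.
    exact/det3_rot_neq0/det3_rot_neq0.
  - by apply/negP => h; apply: hn; exists a, b, c, d; split.
set p := lat v1 in D0 fd *; set q := lat v2 in D0 fd *; set r := lat v3 in D0 fd *.
have D2 : det3 r p q != 0 by exact/det3_rot_neq0/det3_rot_neq0.
have inV v : v \in V -> lattice_hull V (lat v).
  by move=> vV; apply: sub_convex_hull; exists v.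
have Ap : (lat @` [set` V]) p by exists v1.
have Aq : (lat @` [set` V]) q by exists v2.
have cut (sg : R) : sg != 0 ->
    lattice_hull V `&` [set x | 0 <= sg * bary r p q 1 x] =
    lattice_hull [seq v <- V | 0 <= sg * bary r p q 1 (lat v)].
  move=> sg0; rewrite /lattice_hull (cut_hull D0 Ap Aq (ext _ V1) (ext _ V2) sg0).
  by congr convex_hull; apply: image_filter => v _.
apply: (@cut_reciprocity l _ v1 v2 v3 (lat d)) => //; try exact: inV.
- exact: bounded_lattice_hull.
- exact: convex_hull_closed.
- by move=> y; exact: (cut_chord D0 Ap Aq (ext _ V1) (ext _ V2)).
(* The side of [r] loses [d] and the side of [d] loses [r]; the triangles [p, q, r] and [p, q, d]
   keep both pieces two-dimensional. *)
- rewrite cut ?oner_eq0 //; apply: IH.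
    by apply: leq_trans mV; apply: (size_filter_lt Vd); rewrite mul1r -ltNge.
  rewrite -cut ?oner_eq0 //; exists p, q, r; split => //; split; rewrite /= ?mul1r; try exact: inV.
  + by rewrite bary_q.
  + by rewrite bary_r.
  + by rewrite bary_p.
- rewrite cut ?oppr_eq0 ?oner_eq0 //; apply: IH.
    apply: leq_trans mV; apply: (size_filter_lt V3).
    by rewrite mulN1r -/r bary_p // -ltNge oppr_lt0.
  rewrite -cut ?oppr_eq0 ?oner_eq0 //; exists p, q, (lat d).
  split; [split| split|split|]; rewrite /= ?mulN1r ?oppr_ge0; try exact: inV.
  + by rewrite bary_q.
  + by rewrite bary_r.
  + exact: ltW.
  + move: fd; rewrite bary_det3 (det3_rot q (lat d) p) (det3_rot p q (lat d)).
    by apply: contraTneq => ->; rewrite mul0r ltxx.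
Qed.

End Polygon.

(** * Doubling a convex set *)

Section Doubling.
Variable R : realType.
Local Notation lat := (@lattice_point R).
Implicit Types (A P : set 'rV[R]_2) (l : {scalar 'rV[R]_2}) (z v : 'rV[int]_2).

Lemma esum_ge_seq l A n s : (0 < n)%N -> bounded A -> uniq s ->
  (forall z, z \in s -> lset A n z) -> \sum_(z <- s) l (lat z) ^+ 2 <= esum l A n.
Proof.
move=> n0 bA us sA.
have /finite_seqP[t0 t0E] := finite_lset n0 bA.
pose t := undup t0; have ut : uniq t := undup_uniq t0.
have tE z : z \in t <-> lset A n z by rewrite mem_undup t0E.
rewrite (esum_seq l ut tE) [leRHS](bigID (mem s)) /= -[leLHS]addr0 lerD //; last first.
  by apply: sumr_ge0 => z _; exact: sqr_ge0.
have pe : perm_eq s [seq z <- t | z \in s].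
  apply: uniq_perm => //; first exact: filter_uniq.
  by move=> z; rewrite mem_filter andb_idr // => /sA /tE.
by rewrite (perm_big _ pe) /= big_filter.
Qed.

Lemma lset2_sum A v w : segment_closed A -> lset A 1 v -> lset A 1 w -> lset A 2 (v + w).
Proof.
rewrite /lset /= invr1 !scale1r => cA Av Aw.
rewrite latD scalerDr; apply: segment_closed_comb => //; rewrite ?invr_ge0 ?ler0n //.
by lra.
Qed.

(** A strict total order invariant under translation, so that sums of neighbours in an increasing
    list increase too. *)
Definition lex_lt l v w : bool :=
  (l (lat v) < l (lat w)) || ((l (lat v) == l (lat w)) &&
    ((v 0 0 < w 0 0) || ((v 0 0 == w 0 0) && (v 0 1 < w 0 1)))).

Lemma lex_lt_irr l : irreflexive (lex_lt l).
Proof. by move=> v; rewrite /lex_lt !ltxx !andbF. Qed.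

Lemma lex_lt_trans l : transitive (lex_lt l).
Proof.
move=> y x z; rewrite /lex_lt.
move=> /orP[h1|/andP[/eqP-> h1]] /orP[h2|/andP[/eqP<- h2]]; rewrite ?h1 ?h2 //.
  by rewrite (lt_trans h1 h2).
apply/orP; right; rewrite eqxx /=.
move: h1 h2 => /orP[h1|/andP[/eqP-> h1]] /orP[h2|/andP[/eqP<- h2]]; rewrite ?h1 ?h2 //.
  by rewrite (lt_trans h1 h2).
by apply/orP; right; rewrite eqxx /= (lt_trans h1 h2).
Qed.

Lemma lex_lt_total l v w : v != w -> lex_lt l v w || lex_lt l w v.
Proof.
move=> vw; rewrite /lex_lt.
case: (ltgtP (l (lat v)) (l (lat w))) => //= _.
case: (ltgtP (v 0 0) (w 0 0)) => //= e0.
case: (ltgtP (v 0 1) (w 0 1)) => //= e1.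
by move: vw; rewrite (rV2P e0 e1) eqxx.
Qed.

Lemma lex_ltD2l l u v w : lex_lt l (u + v) (u + w) = lex_lt l v w.
Proof. by rewrite /lex_lt !latD !linearD /= !mxE !ltrD2l !(inj_eq (addrI _)). Qed.

Lemma lex_ltD2r l u v w : lex_lt l (v + u) (w + u) = lex_lt l v w.
Proof. by rewrite ![_ + u]addrC lex_ltD2l. Qed.

Fixpoint doubled v (s : seq 'rV[int]_2) : seq 'rV[int]_2 :=
  if s is w :: s' then [:: v + v, v + w & doubled w s'] else [:: v + v].

Fixpoint adj_sum l v (s : seq 'rV[int]_2) : R :=
  if s is w :: s' then (l (lat v) + l (lat w)) ^+ 2 + adj_sum l w s' else 0.

Lemma doubled_path l v s : path (lex_lt l) v s ->
  sorted (lex_lt l) (doubled v s) /\ head 0 (doubled v s) = v + v.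
Proof.
elim: s v => [//|w s IH] v /= /andP[vw ws]; have [so he] := IH _ ws; split => //.
rewrite lex_ltD2l vw /=.
by case: (doubled w s) so he => //= u t -> ->; rewrite lex_ltD2r vw.
Qed.

(** The doubled points give four times the sum over the points; the fifth copy has to come from
    [adj_sum]. *)
Lemma doubled_sum l v s : \sum_(z <- doubled v s) l (lat z) ^+ 2 =
  4 * (\sum_(z <- v :: s) l (lat z) ^+ 2) + adj_sum l v s.
Proof.
elim: s v => [|w s IH] v /=.
  by rewrite !big_seq1 latD linearD /=; ring.
by rewrite !big_cons IH !latD !linearD /= !big_cons; ring.
Qed.

Lemma doubled_lset A v s : segment_closed A ->
  (forall z, z \in v :: s -> lset A 1 z) -> forall z, z \in doubled v s -> lset A 2 z.
Proof.
move=> cA; elim: s v => [|w s IH] v hs z /=.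
  by rewrite inE => /eqP ->; apply: lset2_sum => //; apply: hs; rewrite inE.
have hv : lset A 1 v by apply: hs; rewrite inE eqxx.
have hw : lset A 1 w by apply: hs; rewrite !inE eqxx orbT.
rewrite !inE => /orP[/eqP->|/orP[/eqP->|]]; [exact: lset2_sum|exact: lset2_sum|].
by apply: IH => u hu; apply: hs; rewrite inE hu orbT.
Qed.

Lemma sorted_lex_uniq l s : sorted (lex_lt l) s -> uniq s.
Proof. by apply: sorted_uniq; [exact: lex_lt_trans|exact: lex_lt_irr]. Qed.

(** Each square pays only for its second point, so the head [v] stays uncovered and may be the only
    point. *)
Lemma adj_sum_ge l v s : {in v :: s &, forall x y, 0 <= l (lat x) * l (lat y)} ->
  \sum_(z <- s) l (lat z) ^+ 2 <= adj_sum l v s.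
Proof.
elim: s v => [|w s IH] v hs /=; first by rewrite big_nil.
rewrite big_cons lerD //.
  have := hs v w; rewrite !inE !eqxx orbT => /(_ isT isT).
  by have := sqr_ge0 (l (lat v)); rewrite sqrrD; lra.
by apply: IH => x y hx hy; apply: hs; rewrite inE ?hx ?hy orbT.
Qed.

Lemma adj_sum_ge2 l v w s : {in [:: v, w & s] &, forall x y, 0 <= l (lat x) * l (lat y)} ->
  \sum_(z <- [:: v, w & s]) l (lat z) ^+ 2 <= adj_sum l v (w :: s).
Proof.
move=> hs; rewrite /= !big_cons.
have := hs v w; rewrite !inE !eqxx orbT => /(_ isT isT) hvw.
have : \sum_(z <- s) l (lat z) ^+ 2 <= adj_sum l w s.
  by apply: adj_sum_ge => x y hx hy; apply: hs; rewrite inE ?hx ?hy orbT.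
by rewrite sqrrD; lra.
Qed.

Lemma adj_sum_cat l v s w t :
  adj_sum l v s + adj_sum l w t <= adj_sum l v (s ++ w :: t).
Proof.
elim: s v => [|u s IH] v /=; first by rewrite add0r lerDr sqr_ge0.
by rewrite -addrA lerD2l.
Qed.


Lemma doubling_sorted l A v s : segment_closed A -> bounded A ->
  (forall z, z \in v :: s -> lset A 1 z) -> path (lex_lt l) v s ->
  \sum_(z <- v :: s) l (lat z) ^+ 2 <= adj_sum l v s ->
  5 * \sum_(z <- v :: s) l (lat z) ^+ 2 <= esum l A 2.
Proof.
move=> cA bA sA ps h.
have [so _] := doubled_path ps.
have := esum_ge_seq l (isT : (0 < 2)%N) bA (sorted_lex_uniq so) (doubled_lset cA sA).
by rewrite doubled_sum; lra.
Qed.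

(* If [u] alone is negative, its two nearest neighbours [v], [w] contribute
   [u + v], [u + w] and [v + w], unless [u], [v], [w] are equally spaced. *)
Lemma doubling_one_negative l A u v w s : segment_closed A -> bounded A ->
  (forall z, z \in [:: u, v, w & s] -> lset A 1 z) ->
  path (lex_lt l) u [:: v, w & s] ->
  {in w :: s &, forall x y, 0 <= l (lat x) * l (lat y)} ->
  5 * \sum_(z <- [:: u, v, w & s]) l (lat z) ^+ 2 <= esum l A 2.
Proof.
move=> cA bA sA ps pos; have hs := adj_sum_ge pos.
(* If [u + w = v + v], the extra sum is not a new point; but then the values of [l] are in
   arithmetic progression, and the surplus is [5 * l (lat v) ^+ 2]. *)
have [e|ne] := eqVneq (u + w) (v + v).
  apply: doubling_sorted => //; rewrite /= !big_cons !addrA; apply: lerD => //.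
  have : l (lat u) = 2 * l (lat v) - l (lat w).
    have := congr1 (fun z => l (lat z)) e; rewrite !latD !linearD /=; lra.
  move=> ->; rewrite -subr_ge0.
  by rewrite (_ : _ - _ = 5 * l (lat v) ^+ 2); [rewrite mulr_ge0 ?sqr_ge0|ring].
have [so _] := doubled_path ps.
have uL : uniq (u + w :: doubled u [:: v, w & s]).
  rewrite cons_uniq (sorted_lex_uniq so) andbT; move: ps so => /= /and3P[uv vw _].
  move=> /and4P[_ _ _ pw].
  have hlt : lex_lt l (u + w) (v + w) by rewrite lex_ltD2r.
  rewrite !inE !negb_or ne /=; apply/and4P; split.
  - by apply: contraTneq (lex_lt_trans uv vw) => /addrI ->; rewrite lex_lt_irr.
  - by apply: contraTneq vw => /addrI ->; rewrite lex_lt_irr.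
  - by apply: contraTneq uv => /addIr ->; rewrite lex_lt_irr.
  - apply/negP => hin.
    have /allP/(_ _ hin) := order_path_min (@lex_lt_trans l) pw.
    by move=> h; have := lex_lt_trans h hlt; rewrite lex_lt_irr.
have hL z : z \in u + w :: doubled u [:: v, w & s] -> lset A 2 z.
  rewrite inE => /orP[/eqP ->|]; last exact: doubled_lset.
  by apply: lset2_sum => //; apply: sA; rewrite !inE eqxx ?orbT.
have := esum_ge_seq l (isT : (0 < 2)%N) bA uL hL.
rewrite big_cons doubled_sum latD linearD /= !big_cons.
(* The gain rests on [(a + b)^2 + (a + c)^2 + (b + c)^2 = a^2 + b^2 + c^2 + (a + b + c)^2]. *)
have := sqr_ge0 (l (lat u) + l (lat v) + l (lat w)).
by lra.
Qed.

Lemma sort_lex l (s : seq 'rV[int]_2) : uniq s ->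
  exists2 t, perm_eq t s & pairwise (lex_lt l) t.
Proof.
move=> us; pose leT (x y : 'rV[int]_2) := (x == y) || lex_lt l x y.
have leT_total : total leT.
  move=> x y; rewrite /leT; have [->|xy] := eqVneq x y; first by [].
  exact: lex_lt_total.
have leT_trans : transitive leT.
  move=> y x z; rewrite /leT => /orP[/eqP->//|h1] /orP[/eqP<-|h2]; first by rewrite h1 orbT.
  by rewrite (lex_lt_trans h1 h2) orbT.
exists (sort leT s); first by rewrite perm_sort.
have h1 : pairwise leT (sort leT s) by rewrite -sorted_pairwise // sort_sorted.
have h2 : uniq (sort leT s) by rewrite sort_uniq.
rewrite uniq_pairwise in h2.
have : pairwise [rel x y | leT x y && (x != y)] (sort leT s) by rewrite pairwise_relI h1.
by apply: sub_pairwise => x y /=; rewrite /leT; case: eqVneq => //=; rewrite andbT.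
Qed.

Lemma doubling_sign l A s : segment_closed A -> bounded A -> uniq s ->
  (forall z, z \in s <-> lset A 1 z) -> (2 < size s)%N ->
  (count (fun z => (l (lat z) < 0)%R) s <= 1)%N \/
  count (fun z => 0 <= l (lat z)) s != 1%N ->
  5 * esum l A 1 <= esum l A 2.
Proof.
move=> cA bA us sE s3 hsign; rewrite (esum_seq l us sE).
pose ng z := l (lat z) < 0; pose nn z := 0 <= l (lat z).
have [N pN sN] := sort_lex l (filter_uniq ng us).
have [Q pQ sQ] := sort_lex l (filter_uniq nn us).
have perm : perm_eq (N ++ Q) s.
  apply: perm_trans (perm_cat pN pQ) _.
  have -> : [seq x <- s | nn x] = [seq x <- s | ~~ ng x].
    by apply: eq_filter => z; rewrite /nn /ng -leNgt.
  by rewrite (perm_filterC ng s).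
have Nn z : z \in N -> l (lat z) < 0.
  by rewrite (perm_mem pN) mem_filter => /andP[].
have Qn z : z \in Q -> 0 <= l (lat z).
  by rewrite (perm_mem pQ) mem_filter => /andP[].
have cN : size N = count ng s by rewrite (perm_size pN) size_filter.
have cQ : size Q = count nn s by rewrite (perm_size pQ) size_filter.
have NQ : pairwise (lex_lt l) (N ++ Q).
  rewrite pairwise_cat sN sQ !andbT; apply/allrelP => x y /Nn x0 /Qn y0.
  by rewrite /lex_lt (lt_le_trans x0 y0).
have sNQ z : z \in N ++ Q -> lset A 1 z by rewrite (perm_mem perm) => /sE.
have szNQ : (2 < size (N ++ Q))%N by rewrite (perm_size perm).
rewrite -(perm_big _ perm) /=.
have pp x y : x \in Q -> y \in Q -> 0 <= l (lat x) * l (lat y).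
  by move=> /Qn ? /Qn ?; rewrite mulr_ge0.
have nnp x y : x \in N -> y \in N -> 0 <= l (lat x) * l (lat y).
  by move=> /Nn ? /Nn ?; rewrite ltW // nmulr_lgt0.
have {}NQ := pairwise_sorted NQ.
move: hsign; rewrite -/ng -/nn -cN -cQ => hsign.
(* The cases are no negative value, exactly one, or at least two. In the last case [hsign] excludes
   a single nonnegative value, and the two sign blocks are estimated separately. *)
case: N {pN sN cN perm} Nn NQ sNQ szNQ nnp hsign => [|u [|u' N]] Nn NQ sNQ szNQ nnp hsign.
- case: Q {pQ sQ cQ Qn hsign} NQ sNQ szNQ pp => [//|v [//|w Q]] /= NQ sNQ szNQ pp.
  by apply: doubling_sorted => //; apply: adj_sum_ge2.
- case: Q {pQ sQ cQ Qn hsign} NQ sNQ szNQ pp => [//|v [//|w Q]] /= NQ sNQ szNQ pp.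
  by apply: doubling_one_negative => // x y hx hy; apply: pp; rewrite inE ?hx ?hy orbT.
- case: Q {pQ sQ cQ Qn} NQ sNQ szNQ pp hsign => [|v [|w Q]] NQ sNQ szNQ pp hsign.
  + by rewrite cats0 in NQ sNQ *; apply: doubling_sorted => //; apply: adj_sum_ge2.
  + by case: hsign.
  + rewrite cat_cons in NQ sNQ *; apply: doubling_sorted => //.
    rewrite -cat_cons big_cat; apply: le_trans (adj_sum_cat l u (u' :: N) v (w :: Q)).
    by apply: lerD; exact: adj_sum_ge2.
Qed.

(** Replacing [l] by its opposite changes no square and turns a single nonnegative value into at
    most one negative value. *)
Lemma doubling l A s : segment_closed A -> bounded A -> uniq s ->
  (forall z, z \in s <-> lset A 1 z) -> (2 < size s)%N ->
  5 * esum l A 1 <= esum l A 2.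
Proof.
move=> cA bA us sE s3.
have [h|] := boolP ((count (fun z => (l (lat z) < 0)%R) s <= 1)%N ||
  (count (fun z => (0 <= l (lat z))%R) s != 1%N)).
  by apply: doubling_sign us sE s3 _ => //; apply/orP.
rewrite negb_or negbK => /andP[_ /eqP c1].
pose l' : {scalar 'rV[R]_2} := \- l.
have e n : esum l A n = esum l' A n.
  by apply: eq_fsbigr => z _; rewrite /= sqrrN.
rewrite !e; apply: doubling_sign us sE s3 _ => //; left.
have : (count (fun z => (l' (lat z) < 0)%R) s <=
        count (fun z => (0 <= l (lat z))%R) s)%N.
  by apply: sub_count => z /=; rewrite oppr_lt0 => /ltW.
by rewrite c1.
Qed.

End Doubling.

(** * Doubling for interiors and for closed polygons *)

Section Interior.
Variable R : realType.
Local Notation lat := (@lattice_point R).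
Implicit Types (A P : set 'rV[R]_2) (l : {scalar 'rV[R]_2}) (z v : 'rV[int]_2).

Lemma addrr_inj (x y : int) : x + x = y + y -> x = y.
Proof. by lia. Qed.

Lemma row_free_cross (u v : 'rV[R]_2) : row_free (col_mx u v) -> cross u v != 0.
Proof.
move=> /row_freeP[B]; rewrite mul_col_mx => hB.
have mE (x : 'rV[R]_2) i : (x *m B) 0 i = x 0 0 * B 0 i + x 0 1 * B 1 i.
  rewrite mxE big_ord_recl big_ord1; congr (_ * _ + x _ _ * B _ _); exact/val_inj.
pose i0 : 'I_(1 + 1) := lshift 1 0; pose i1 : 'I_(1 + 1) := rshift 1 0.
have e i : (u *m B) 0 i = (1%:M : 'M[R]_(1 + 1)) i0 i by rewrite -hB col_mxEu.
have f i : (v *m B) 0 i = (1%:M : 'M[R]_(1 + 1)) i1 i by rewrite -hB col_mxEd.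
have e0 : u 0 0 * B 0 i0 + u 0 1 * B 1 i0 = 1 by rewrite -mE e mxE.
have e1 : u 0 0 * B 0 i1 + u 0 1 * B 1 i1 = 0 by rewrite -mE e mxE.
have f0 : v 0 0 * B 0 i0 + v 0 1 * B 1 i0 = 0 by rewrite -mE f mxE.
have f1 : v 0 0 * B 0 i1 + v 0 1 * B 1 i1 = 1 by rewrite -mE f mxE.
(* Multiplicativity of the determinant, for a right inverse [B]. *)
have : cross u v * (B 0 i0 * B 1 i1 - B 1 i0 * B 0 i1) = 1.
  transitivity ((u 0 0 * B 0 i0 + u 0 1 * B 1 i0) * (v 0 0 * B 0 i1 + v 0 1 * B 1 i1) -
    (u 0 0 * B 0 i1 + u 0 1 * B 1 i1) * (v 0 0 * B 0 i0 + v 0 1 * B 1 i0)).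
    by rewrite /cross; ring.
  by rewrite e0 e1 f0 f1 mul0r subr0 mulr1.
by apply: contra_eq_neq => ->; rewrite mul0r eq_sym oner_neq0.
Qed.

Lemma lset1 A v : lset A 1 v = A (lat v).
Proof. by rewrite /lset /= invr1 scale1r. Qed.

(** The midpoint of an interior point and any point of [A] is interior, so [u] may be a vertex of
    the polygon. *)
Lemma lset2_core A v u : segment_closed A -> core A (lat v) -> A (lat u) ->
  lset (core A) 2 (v + u).
Proof.
move=> cA cv Au; rewrite /lset /= latD.
have -> : 2^-1 *: (lat v + lat u) = lat v + 2^-1 *: (lat u - lat v).
  by move: (lat v) (lat u) => x y; apply: rV2P; rewrite !mxE; field.
by apply: core_mix => //; rewrite invf_lt1 // ltr1n.
Qed.

Lemma esum_ge0 l A n : 0 <= esum l A n.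
Proof. by apply: fsumr_ge0 => z _; exact: sqr_ge0. Qed.

Lemma core_doubling l V (P := @lattice_hull R V) :
  5 * esum l (core P) 1 <= esum l (core P) 2.
Proof.
have cP : segment_closed P by exact: convex_hull_closed.
have bc : bounded (core P).
  by apply: bounded_sub (bounded_lattice_hull R V); exact: core_sub.
have VP u : u \in V -> P (lat u) by move=> Vu; apply: sub_convex_hull; exists u.
have /finite_seqP[s0 s0E] := finite_lset (isT : (0 < 1)%N) bc.
pose s := undup s0; have us : uniq s := undup_uniq s0.
have sE z : z \in s <-> lset (core P) 1 z by rewrite mem_undup s0E.
have [s3|] := ltnP 2 (size s).
  by apply: (doubling l _ bc us sE s3); exact: core_closed.
rewrite (esum_seq l us sE).
have sc z : z \in s -> core P (lat z) by move=> /sE; rewrite lset1.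
case: s us {sE} sc => [|v [|w [|//]]] us sc _.
- by rewrite big_nil mulr0 esum_ge0.
- have cv : core P (lat v) by apply: sc; rewrite inE.
  rewrite big_seq1; have [->|a0] := eqVneq (l (lat v)) 0.
    by rewrite expr0n mulr0 esum_ge0.
  have a2 : 0 < l (lat v) ^+ 2 by rewrite exprn_even_gt0.
  (* As [v] is interior, the value of [l] at some generator has the same sign as at [v] and is
     larger in absolute value; then [v + v] and [v + u] suffice. *)
  have [u Vu hu] : exists2 u, u \in V & l (lat v) ^+ 2 < l (lat u) * l (lat v).
    apply: contrapT => hn.
    have hP : P `<=` [set x | l x * l (lat v) <= l (lat v) ^+ 2].
      apply: convex_hull_sub.
        move=> x y t /= hx hy t0 t1; rewrite linearD linearZ linearB /=.
        by move: (l x) (l y) (l (lat v)) hx hy => a b c hx hy; nra.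
      move=> _ [u /= Vu <-]; rewrite leNgt; apply/negP => h.
      by apply: hn; exists u.
    have [e e0 /hP /=] := cv (lat v).
    by rewrite linearD linearZ /= mulrDl -mulrA -expr2; nra.
  have uL : uniq [:: v + v; v + u].
    rewrite /= inE andbT; apply: contraTneq hu => /addrI <-.
    by rewrite -expr2 ltxx.
  have hL z : z \in [:: v + v; v + u] -> lset (core P) 2 z.
    rewrite !inE => /orP[] /eqP->; apply: lset2_core => //; last exact: VP.
    exact: core_sub.
  have := esum_ge_seq l (isT : (0 < 2)%N) bc uL hL.
  rewrite big_cons big_seq1 !latD !linearD /=.
  by move: (l (lat v)) (l (lat u)) hu a2 => a b hu a2; have := sqr_ge0 b; nra.
- have cv : core P (lat v) by apply: sc; rewrite inE eqxx.
  have cw : core P (lat w) by apply: sc; rewrite !inE eqxx orbT.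
  have vw : v != w by move: us; rewrite /= inE andbT.
  have [u Vu hu] : exists2 u, u \in V & det3 (lat v) (lat w) (lat u) != 0.
    apply: contrapT => hn.
    have hP : P `<=` [set x | det3 (lat v) (lat w) x = 0].
      apply: convex_hull_sub.
        by move=> x y t /= hx hy _ _; rewrite det3_affine hx hy !mulr0 addr0.
      move=> _ [u /= Vu <-]; apply/eqP; apply/negPn/negP => h.
      by apply: hn; exists u.
    (* [nv] is orthogonal to [w - v], so a step along it from the interior point [v] leaves the line
       through [v] and [w] while staying in [P]. *)
    pose nv : 'rV[R]_2 := \row_(i < 2) if i == 0 then - (lat w - lat v) 0 1
                                     else (lat w - lat v) 0 0.
    have [e e0 /hP /=] := cv nv.
    rewrite /nv; have : lat v != lat w by rewrite (inj_eq (@lat_inj R)).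
    move: (lat v) (lat w) => x y xy.
    have -> : det3 x y (x + e *: \row_i (if i == 0 then - (y - x) 0 1 else (y - x) 0 0))
      = e * ((y 0 0 - x 0 0) ^+ 2 + (y 0 1 - x 0 1) ^+ 2).
      by rewrite /det3 /cross !mxE /=; ring.
    move/eqP; rewrite mulf_eq0 gt_eqF //= paddr_eq0 ?sqr_ge0 // !sqrf_eq0 !subr_eq0.
    by move=> /andP[/eqP h0 /eqP h1]; rewrite (rV2P h0 h1) eqxx in xy.
  have nu (x : 'rV[int]_2) : det3 (lat v) (lat w) (lat x) = 0 -> u != x.
    by move=> h; apply: contra_neq hu => ->.
  have uv : u != v by apply: nu; rewrite /det3 /cross; ring.
  have uw : u != w by apply: nu; rewrite /det3 /cross; ring.
  (* This and [uww] exclude [v + v = w + u] and [w + w = v + u]. *)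
  have uvv : u != v + v - w.
    apply: nu; rewrite latB latD; move: (lat v) (lat w) => x y.
    by rewrite /det3 /cross !mxE; ring.
  have uww : u != w + w - v.
    apply: nu; rewrite latB latD; move: (lat v) (lat w) => x y.
    by rewrite /det3 /cross !mxE; ring.
  pose L := [:: v + v; w + w; v + w; v + u; w + u].
  have uL : uniq L.
    have vvww : v + v != w + w.
      apply: contra_neq vw => e; apply: rV2P.
        by have := congr1 (fun z : 'rV[int]_2 => z 0 0) e; rewrite !mxE => /addrr_inj.
      by have := congr1 (fun z : 'rV[int]_2 => z 0 1) e; rewrite !mxE => /addrr_inj.
    rewrite /= !inE !negb_or vvww !(inj_eq (addrI _)) !(inj_eq (addIr _)).
    rewrite (eq_sym v u) (eq_sym w u) uv uw vw [w == v]eq_sym vw /= !andbT.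
    rewrite [v + w]addrC (inj_eq (addrI _)) [v == u]eq_sym uv /=.
    apply/and3P; split.
    - by apply: contra_neq uvv => ->; rewrite addrAC subrr add0r.
    - by apply: contra_neq uww => ->; rewrite addrAC subrr add0r.
    - by [].
  have hL z : z \in L -> lset (core P) 2 z.
    by rewrite !inE => /or4P[/eqP->|/eqP->|/eqP->|/orP[]/eqP->]; apply: lset2_core => //;
      try (exact: VP); exact: core_sub.
  have := esum_ge_seq l (isT : (0 < 2)%N) bc uL hL.
  rewrite !big_cons !big_nil !latD !linearD /=.
  (* The five squares add up to [5 a^2 + 5 b^2 + c^2 + (a + b + c)^2]. *)
  move: (l (lat v)) (l (lat w)) (l (lat u)) => a b c.
  by have := sqr_ge0 (a + b + c); have := sqr_ge0 c; lra.
Qed.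

Lemma closed_doubling l V (P := @lattice_hull R V) v1 v2 v3 :
  P (lat v1) -> P (lat v2) -> P (lat v3) -> det3 (lat v1) (lat v2) (lat v3) != 0 ->
  5 * esum l P 1 <= esum l P 2.
Proof.
move=> P1 P2 P3 D0.
have bP : bounded P := bounded_lattice_hull R V.
have /finite_seqP[s0 s0E] := finite_lset (isT : (0 < 1)%N) bP.
pose s := undup s0; have us : uniq s := undup_uniq s0.
have sE z : z \in s <-> lset P 1 z by rewrite mem_undup s0E.
apply: (doubling l _ bP us sE); first exact: convex_hull_closed.
have u3 : uniq [:: v1; v2; v3].
  rewrite /= !inE negb_or andbT; apply/andP; split; [apply/andP; split|];
  by apply: contra_neq D0 => ->; rewrite /det3 /cross; ring.
apply: (uniq_leq_size u3) => z.
by rewrite !inE => /or3P[] /eqP->; apply/sE; rewrite lset1.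
Qed.

End Interior.

(** * From reciprocity to nonnegative coefficients *)

Section Hstar.
Variable R : realType.

Lemma coef_onesubX5 k : ((1 - 'X) ^+ (2 + 3) : {poly R})`_k =
  [:: 1; -5; 10; -10; 5; -1]`_k.
Proof.
suff -> : (1 - 'X) ^+ (2 + 3) = Poly [:: 1; -5; 10; -10; 5; -1] :> {poly R}.
  by rewrite coef_Poly.
rewrite /= !cons_poly_def; ring.
Qed.

(** A coefficient of index at least 5 is a fifth difference of a polynomial of degree at most 4,
    hence zero. The same vanishing difference, taken down to the arguments -1 and -2, expresses the
    coefficients of index 4 and 3 through [Ei]. *)
Lemma hstar_of_reciprocal (E Ei : nat -> R) : E 0%N = 0 -> reciprocal E Ei ->
  0 <= E 1%N -> 5 * E 1%N <= E 2%N -> 0 <= Ei 1%N -> 5 * Ei 1%N <= Ei 2%N ->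
  exists h : {poly R}, (forall n : nat,
    \sum_(k < n.+1) ((1 - 'X) ^+ (2 + 3) : {poly R})`_k * E (n - k)%N = h`_n) /\
  (forall i : nat, 0 <= h`_i).
Proof.
move=> E0 [c1 [c2 [c3 [c4 hc]]]] E1 E2 Ei1 Ei2.
pose q (x : R) := c1 * x + c2 * x ^+ 2 + c3 * x ^+ 3 + c4 * x ^+ 4.
(* [E 0 = 0] extends the polynomial formula to [n = 0], as the difference for index 5 needs. *)
have Eq n : E n = q n%:R.
  by case: n => [|n]; [rewrite E0 /q; ring|have [->] := hc n.+1 isT].
have [_ Ei1E] := hc 1%N isT; have [_ Ei2E] := hc 2%N isT.
pose H n := \sum_(k < n.+1) ((1 - 'X) ^+ (2 + 3) : {poly R})`_k * E (n - k)%N.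
exists (\poly_(i < 5) H i); split => n; rewrite coef_poly; case: ltnP => // n5.
  rewrite -(big_mkord xpredT (fun k => ((1 - 'X) ^+ (2 + 3) : {poly R})`_k * E (n - k)%N)).
  rewrite (@big_cat_nat _ _ _ 6) //= [X in _ + X]big_nat_cond [X in _ + X]big1 ?addr0; last first.
    by move=> k; rewrite andbT => /andP[k6 _]; rewrite coef_onesubX5 nth_default ?mul0r.
  rewrite big_mkord !big_ord_recl big_ord0 !coef_onesubX5 /= !Eq.
  by rewrite /bump /= !natrB //; [rewrite /q; ring|lia..].
rewrite /H; case: n n5 => [|[|[|[|[|//]]]]] _;
  rewrite !big_ord_recl big_ord0 !coef_onesubX5 /= ?subn0 ?E0.
- by rewrite mulr0 addr0.
- by lra.
- by lra.
- rewrite -[(3 - bump 0 0)%N]/2%N -[(3 - _)%N]/1%N.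
  by move: Ei2; rewrite Ei1E Ei2E !Eq /q; lra.
- rewrite -[(4 - bump 0 0)%N]/3%N -[(4 - bump 0 (bump 0 0))%N]/2%N -[(4 - _)%N]/1%N.
  by move: Ei1; rewrite Ei1E !Eq /q; lra.
Qed.

End Hstar.

Theorem theorem3p3 (R : realType) (P : set 'rV[R]_2) (l : {scalar 'rV[R]_2})
    (hP : lattice_polygon P) :
  exists h : {poly R},
    is_weighted_hstar P 2 (fun x => l x ^+ 2) h /\ (forall i : nat, 0 <= h`_i).
Proof.
case: hP => -[a [b [c [Pa Pb Pc free]]]] [V0 [/finite_seqP[V V0E] PE]].
have {V0E}PE : P = @lattice_hull R V by rewrite PE V0E.
have D0 : det3 a b c != 0.
  by rewrite det3_row row_free_cross.
have [v1 [v2 [v3 [V1 V2 V3 D]]]] : exists v1 v2 v3, [/\ v1 \in V, v2 \in V, v3 \in V &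
    det3 (lattice_point R v1) (lattice_point R v2) (lattice_point R v3) != 0].
  apply: contrapT => hn; move/eqP : D0; apply.
  rewrite PE in Pa Pb Pc.
  apply: (det3_hull _ Pa Pb Pc) => _ _ _ [x /= Vx <-] [y /= Vy <-] [z /= Vz <-].
  by apply/eqP; apply/negPn/negP => D; apply: hn; exists x, y, z.
have inP v : v \in V -> @lattice_hull R V (lattice_point R v).
  by move=> vV; apply: sub_convex_hull; exists v.
have EE n : (0 < n)%N -> weighted_ehrhart P (fun x => l x ^+ 2) n = esum l P n.
  move=> n0; rewrite /weighted_ehrhart /esum.
  have nn : n%:R != 0 :> R by rewrite pnatr_eq0 -lt0n.
  suff -> : lattice_point R @^-1` dilate n P = lset P n by [].
  apply/seteqP; split => z /=.
    by move=> [x Px e]; rewrite /lset /= -e scalerA mulVf // scale1r.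
  by move=> Pz; exists (n%:R^-1 *: lattice_point R z) => //; rewrite scalerA mulfV // scale1r.
apply: (@hstar_of_reciprocal _ (weighted_ehrhart P (fun x => l x ^+ 2))
   (esum l (core P))).
(* The dilate by 0 is the origin, where the weight vanishes; [lset] does not describe it, because
   there [0^-1 = 0] by convention. *)
- rewrite /weighted_ehrhart; apply: fsbig1 => z /= [x _ <-].
  by rewrite scale0r linear0 expr0n.
- apply: reciprocal_ext (_ : reciprocal (esum l P) _).
    by move=> n n0; rewrite EE.
  by rewrite PE; apply: polygon_reciprocity; exists a, b, c; rewrite -PE.
- by rewrite EE // esum_ge0.
- by rewrite !EE // PE; apply: (closed_doubling l _ _ _ D); exact: inP.
- exact: esum_ge0.
- by rewrite PE; exact: core_doubling.
Qed.
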